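(* Let $\mathbf q=(q_{ij})$ be a multiplicatively antisymmetric complex $n\times n$ matrix with $|q_{ij}|=1$ for all $i,j$, and let $r,R\in[0,+\infty]^n$ with $r_i<R_i$ for all $i$. Then the algebra $\mathcal O_{\mathbf q}(\mathbb D^n_{r,R})$ of holomorphic functions on the quantum polyannulus is holomorphically finitely generated.
   Context: Conventions: algebras complex, associative, unital. $\mathbf q$ is multiplicatively antisymmetric if $q_{ii}=1$ and $q_{ji}=q_{ij}^{-1}$. $\mathcal O^{\mathrm{reg}}_{\mathbf q}((\mathbb C^\times)^n)$ is the algebra generated by $x_1^{\pm1},\dots,x_n^{\pm1}$ with relations $x_ix_j=q_{ij}x_jx_i$ and $x_ix_i^{-1}=x_i^{-1}x_i=1$; the Laurent monomials $x^k=x_1^{k_1}\cdots x_n^{k_n}$ ($k\in\mathbb Z^n$) form a basis. For $k\in\mathbb Z^n$ let $k^+_i=\max\{k_i,0\}$, $k^-_i=\min\{k_i,0\}$; for $\rho,\tau\in(0,\infty)^n$, $\rho^{k}=\prod\rho_i^{k_i}$. Write $\rho<\tau$ if $\rho_i<\tau_i$ for all $i$, and $(r,R)=\prod(r_i,R_i)$. Define $\mathcal O_{\mathbf q}(\mathbb D^n_{r,R})=\{a=\sum_{k\in\mathbb Z^n}c_kx^k:\|a\|_{\rho,\tau}=\sum_k|c_k|\rho^{k^-}\tau^{k^+}<\infty\ \forall\rho,\tau\in(r,R),\ \rho<\tau\}$, with topology given by these norms and multiplication determined by $x_ix_j=q_{ij}x_jx_i$ (the completion of $\mathcal O^{\mathrm{reg}}_{\mathbf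 q}((\mathbb C^\times)^n)$ in these submultiplicative norms). An Arens–Michael algebra is a complete Hausdorff locally convex algebra whose topology is given by submultiplicative seminorms. HFG: for words $\alpha=(\alpha_1,\dots,\alpha_d)$ in $\{1,\dots,N\}$, $\mathcal F_N$ is the algebra of series $f=\sum c_\alpha\zeta_\alpha$ with $\sum|c_\alpha|\rho^{d}<\infty$ for all $\rho>0$ (concatenation product); for an Arens–Michael algebra $A$ and $a\in A^N$, $f(a)=\sum c_\alpha a_{\alpha_1}\cdots a_{\alpha_d}$. A subalgebra $B\subseteq A$ is holomorphically closed if $f(b)\in B$ for all $N$, $b\in B^N$, $f\in\mathcal F_N$; $\mathrm{Hol}(S)$ is the intersection of all holomorphically closed subalgebras containing $S$. A Fréchet Arens–Michael algebra $A$ is holomorphically finitely generated (HFG) if $A=\mathrm{Hol}(S)$ for some finite $S$. *)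

(* Defs.v *)
From Stdlib Require Import Reals Lra ZArith List ClassicalEpsilon.
Import ListNotations.
Open Scope R_scope.

Definition CC : Type := (R * R)%type.
Definition C0 : CC := (0, 0).
Definition C1 : CC := (1, 0).
Definition Cadd (a b : CC) : CC := (fst a + fst b, snd a + snd b).
Definition Cneg (a : CC) : CC := (- fst a, - snd a).
Definition Csub (a b : CC) : CC := Cadd a (Cneg b).
Definition Cmul (a b : CC) : CC :=
  (fst a * fst b - snd a * snd b, fst a * snd b + snd a * fst b).
Definition Cinv (a : CC) : CC :=
  (fst a / (fst a ^ 2 + snd a ^ 2), - snd a / (fst a ^ 2 + snd a ^ 2)).
Definition Cmod (a : CC) : R := sqrt (fst a ^ 2 + snd a ^ 2).
Fixpoint Cpow (a : CC) (m : nat) : CC :=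
  match m with O => C1 | S m' => Cmul a (Cpow a m') end.
Definition Cpowz (a : CC) (z : Z) : CC :=
  match z with
  | Z0 => C1
  | Zpos p => Cpow a (Pos.to_nat p)
  | Zneg p => Cinv (Cpow a (Pos.to_nat p))
  end.

Definition lsumR {X : Type} (g : X -> R) (G : list X) : R :=
  fold_right (fun x acc => g x + acc) 0 G.
Definition lsumC {X : Type} (f : X -> CC) (G : list X) : CC :=
  fold_right (fun x acc => Cadd (f x) acc) C0 G.

Definition summable {X : Type} (g : X -> R) : Prop :=
  exists M : R, forall G : list X, NoDup G -> lsumR g G <= M.

Definition has_sumR {X : Type} (g : X -> R) (s : R) : Prop :=
  forall eps, 0 < eps -> exists F : list X, forall G : list X,
    NoDup G -> incl F G -> Rabs (lsumR g G - s) < eps.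
Definition has_sumC {X : Type} (f : X -> CC) (s : CC) : Prop :=
  forall eps, 0 < eps -> exists F : list X, forall G : list X,
    NoDup G -> incl F G -> Cmod (Csub (lsumC f G) s) < eps.

Definition Rsum {X : Type} (g : X -> R) : R :=
  epsilon (inhabits 0) (fun s => has_sumR g s).
Definition Csum {X : Type} (f : X -> CC) : CC :=
  epsilon (inhabits C0) (fun s => has_sumC f s).

(* multi-indices k in Z^n are lists of length n; coordinate i is nth i k 0 *)
Definition mindex := list Z.
(* a formal series sum_k c_k x^k, given by its coefficients; coefficients at
   lists of the wrong length are required to vanish (see InA) *)
Definition coef := mindex -> CC.

Definition kcoord (k : mindex) (i : nat) : Z := nth i k 0%Z.
Definition vsub (n : nat) (m k : mindex) : mindex :=
  map (fun i => (kcoord m i - kcoord k i)%Z) (seq 0 n).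
Definition zero_index (n : nat) : mindex := repeat 0%Z n.

Definition cadd (a b : coef) : coef := fun k => Cadd (a k) (b k).
Definition csub (a b : coef) : coef := fun k => Csub (a k) (b k).
Definition cscale (c : CC) (a : coef) : coef := fun k => Cmul c (a k).
Definition cunit (n : nat) : coef :=
  fun k => if list_eq_dec Z.eq_dec k (zero_index n) then C1 else C0.

Fixpoint Cprod (f : nat -> CC) (m : nat) : CC :=
  match m with O => C1 | S m' => Cmul (Cprod f m') (f m') end.

(* x^k x^l = theta(k,l) x^(k+l), theta(k,l) = prod_{i>j} q_ij^(k_i l_j),
   from x_i x_j = q_ij x_j x_i *)
Definition theta (n : nat) (q : nat -> nat -> CC) (k l : mindex) : CC :=
  Cprod (fun i => Cprod (fun j => Cpowz (q i j) (kcoord k i * kcoord l j)%Z) i) n.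

Definition cmul (n : nat) (q : nat -> nat -> CC) (a b : coef) : coef :=
  fun m =>
    if Nat.eqb (length m) n then
      Csum (fun k : mindex =>
        if Nat.eqb (length k) n then
          Cmul (Cmul (a k) (b (vsub n m k))) (theta n q k (vsub n m k))
        else C0)
    else C0.

Definition weight (n : nat) (rho tau : nat -> R) (k : mindex) : R :=
  fold_right Rmult 1
    (map (fun i => if Z.ltb (kcoord k i) 0
                   then powerRZ (rho i) (kcoord k i)
                   else powerRZ (tau i) (kcoord k i)) (seq 0 n)).

Definition cnorm (n : nat) (rho tau : nat -> R) (a : coef) : R :=
  Rsum (fun k : mindex => Cmod (a k) * weight n rho tau k).

(* extended upper radii: None stands for +infinity *)
Definition below (Ri : option R) (x : R) : Prop :=
  match Ri with None => True | Some y => x < y end.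
Definition ltext (x : R) (Ri : option R) : Prop := below Ri x.

Definition admissible (n : nat) (r : nat -> R) (Rr : nat -> option R)
  (rho tau : nat -> R) : Prop :=
  forall i, (i < n)%nat -> r i < rho i /\ rho i < tau i /\ below (Rr i) (tau i).

Definition InA (n : nat) (r : nat -> R) (Rr : nat -> option R) (a : coef) : Prop :=
  (forall k, length k <> n -> a k = C0) /\
  (forall rho tau, admissible n r Rr rho tau ->
     summable (fun k : mindex => Cmod (a k) * weight n rho tau k)).

Definition FrechetAM (n : nat) (q : nat -> nat -> CC) (r : nat -> R)
  (Rr : nat -> option R) : Prop :=
  (InA n r Rr (cunit n)) /\
  (forall a b, InA n r Rr a -> InA n r Rr b ->
     InA n r Rr (cadd a b) /\ (forall c, InA n r Rr (cscale c a)) /\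
     InA n r Rr (cmul n q a b) /\
     forall rho tau, admissible n r Rr rho tau ->
       cnorm n rho tau (cmul n q a b) <= cnorm n rho tau a * cnorm n rho tau b) /\
  (forall a, InA n r Rr a ->
     (forall rho tau, admissible n r Rr rho tau -> cnorm n rho tau a = 0) ->
     a = (fun _ => C0)) /\
  (* metrizable: the topology is defined by a countable subfamily *)
  (exists (rs ts : nat -> nat -> R),
     (forall m, admissible n r Rr (rs m) (ts m)) /\
     forall rho tau, admissible n r Rr rho tau ->
       exists m K, forall a, InA n r Rr a ->
         cnorm n rho tau a <= K * cnorm n (rs m) (ts m) a) /\
  (forall x : nat -> coef, (forall m, InA n r Rr (x m)) ->
     (forall rho tau, admissible n r Rr rho tau -> forall eps, 0 < eps ->
        exists M, forall m p, (M <= m)%nat -> (M <= p)%nat ->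
          cnorm n rho tau (csub (x m) (x p)) < eps) ->
     exists y, InA n r Rr y /\
       forall rho tau, admissible n r Rr rho tau -> forall eps, 0 < eps ->
         exists M, forall m, (M <= m)%nat -> cnorm n rho tau (csub (x m) y) < eps).

(* words alpha over the alphabet {0,...,N-1} (the paper uses {1,...,N}) *)
Definition word := list nat.

Definition InFN (N : nat) (c : word -> CC) : Prop :=
  (forall alpha, ~ (forall i, In i alpha -> (i < N)%nat) -> c alpha = C0) /\
  (forall rho, 0 < rho -> summable (fun alpha : word => Cmod (c alpha) * rho ^ length alpha)).

Definition word_eval (n : nat) (q : nat -> nat -> CC) (b : nat -> coef) (alpha : word) : coef :=
  fold_right (fun i p => cmul n q (b i) p) (cunit n) alpha.

Definition lsumA {X : Type} (F : X -> coef) (G : list X) : coef :=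
  fold_right (fun x acc => cadd (F x) acc) (fun _ => C0) G.

Definition A_sum (n : nat) (r : nat -> R) (Rr : nat -> option R)
  {X : Type} (F : X -> coef) (s : coef) : Prop :=
  InA n r Rr s /\
  forall rho tau, admissible n r Rr rho tau -> forall eps, 0 < eps ->
    exists Fl : list X, forall G : list X, NoDup G -> incl Fl G ->
      cnorm n rho tau (csub (lsumA F G) s) < eps.

Definition fcalc (n : nat) (q : nat -> nat -> CC) (r : nat -> R) (Rr : nat -> option R)
  (c : word -> CC) (b : nat -> coef) (s : coef) : Prop :=
  A_sum n r Rr (fun alpha : word => cscale (c alpha) (word_eval n q b alpha)) s.

Definition hol_closed (n : nat) (q : nat -> nat -> CC) (r : nat -> R)
  (Rr : nat -> option R) (B : coef -> Prop) : Prop :=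
  (forall a, B a -> InA n r Rr a) /\
  B (cunit n) /\
  (forall a b, B a -> B b -> B (cadd a b)) /\
  (forall c a, B a -> B (cscale c a)) /\
  (forall a b, B a -> B b -> B (cmul n q a b)) /\
  (forall (N : nat) (b : nat -> coef) (c : word -> CC) (s : coef),
     (forall i, (i < N)%nat -> B (b i)) -> InFN N c -> fcalc n q r Rr c b s -> B s).

Definition Hol (n : nat) (q : nat -> nat -> CC) (r : nat -> R) (Rr : nat -> option R)
  (S : list coef) (a : coef) : Prop :=
  forall B, hol_closed n q r Rr B -> (forall s, In s S -> B s) -> B a.

Definition HFG_Oq (n : nat) (q : nat -> nat -> CC) (r : nat -> R) (Rr : nat -> option R) : Prop :=
  FrechetAM n q r Rr /\
  exists S : list coef, (forall s, In s S -> InA n r Rr s) /\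
    forall a, InA n r Rr a <-> Hol n q r Rr S a.

(* Main.v *)
(** The algebra A is exhausted by an increasing sequence of weighted l1-norms |.|_m.  A finite set
    S of generators has Hol(S) = A as soon as, for each m, every monomial x^k is approximated
    arbitrarily well in |.|_(m+1) by noncommutative polynomials P in S whose norm |P|_(t_m) on the
    free algebra is at most C_m |x^k|_m, where t_m tends to infinity: a telescoping sum of
    corrections then writes each element of A as f(S) with f free entire.

    Since |q_ij| = 1, the norms are submultiplicative, so one may treat one variable y = x_i or x_i^-1
    at a time, with radii s_0 < s_1 < ...  There the generators are y and the two lacunary series
    g = sum (y/c_l)^(n_l) over l even and over l odd, where c_l increases through the radii.
    On the circles used at level m the m-th term of the series of the same parity dominates all
    the others, because the next term of that series only becomes large two levels later.
    Hence y^(n_m) may be replaced by a multiple of g minus a small remainder, and iterating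
    this substitution gives the polynomial P. *)

From Stdlib Require Import Reals Lra Lia ZArith List ClassicalEpsilon FinFun FunctionalExtensionality Permutation.
From Coquelicot Require Complex.
Require Import Defs.
Import ListNotations.
Open Scope R_scope.

(** The lacunary series answer a cost problem. On the free algebra the word y^j costs t_m^j, and
    when the radii stay bounded t_m outgrows them, so words in y alone are too expensive compared
    with |y^j|_m. The series g is a single letter of cost t_m that contains y^(n_m) with coefficient
    c_m^(-n_m); extracting y^(n_m) from it costs about t_m c_m^(n_m), which for large n_m is below
    s^(n_m) for any given radius s > c_m.

    Level m uses three radii, in the numbering of [rseq] and [tseq]: 3m+1 for the cost, 3m+4 for the
    error, and 3m+5 as the auxiliary scale on which a substitution contracts the error. As 3(m+1)+1
    = 3m+4, the error left by level m is exactly the input that level m+1 pays for. With c_l placed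
    at 3l, term l is small up to 3l-1. At 3m+5 this covers l >= m+2 but not l = m+1, and that single
    term is what the splitting by parity removes. *)

Lemma CC_ring : ring_theory C0 C1 Cadd Cmul Csub Cneg (@eq CC).
Proof.
constructor; intros; try reflexivity;
  repeat match goal with x : CC |- _ => destruct x end;
  unfold Cadd, Cmul, Csub, Cneg, C0, C1; simpl; apply injective_projections; simpl; ring.
Qed.
Add Ring CC_ring : CC_ring.

(** * Modulus of complex numbers, by conversion with Coquelicot *)

Lemma Cmod_nonneg a : 0 <= Cmod a.
Proof. exact (Complex.Cmod_ge_0 a). Qed.
Lemma Cmod_C0 : Cmod C0 = 0.
Proof. exact Complex.Cmod_0. Qed.
Lemma Cmod_C1 : Cmod C1 = 1.
Proof. exact Complex.Cmod_1. Qed.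
Lemma Cmod_add a b : Cmod (Cadd a b) <= Cmod a + Cmod b.
Proof. exact (Complex.Cmod_triangle a b). Qed.
Lemma Cmod_Cmul a b : Cmod (Cmul a b) = Cmod a * Cmod b.
Proof. exact (Complex.Cmod_mult a b). Qed.
Lemma Cmod_neg a : Cmod (Cneg a) = Cmod a.
Proof. exact (Complex.Cmod_opp a). Qed.
Lemma Cmod_eq0 a : Cmod a = 0 -> a = C0.
Proof. exact (Complex.Cmod_eq_0 a). Qed.
Lemma Cmod_real x : Cmod (x, 0) = Rabs x.
Proof. exact (Complex.Cmod_R x). Qed.
Lemma Cmod_sub_sym a b : Cmod (Csub a b) = Cmod (Csub b a).
Proof. rewrite <- (Cmod_neg (Csub a b)); f_equal; ring. Qed.
Lemma Cmod_inv_unit a : Cmod a = 1 -> Cmod (Cinv a) = 1.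
Proof.
intro H.
assert (Hn : a <> Complex.RtoC 0).
{ intro E. rewrite E in H. assert (Cmod (Complex.RtoC 0) = 0) by exact Complex.Cmod_0. lra. }
pose proof (Complex.Cmod_inv a Hn) as E.
change (Cmod (Cinv a) = / Cmod a) in E. rewrite E, H; field.
Qed.
Lemma fst_le_Cmod a : Rabs (fst a) <= Cmod a.
Proof. eapply Rle_trans; [apply Rmax_l | apply (Complex.Rmax_Cmod a)]. Qed.
Lemma snd_le_Cmod a : Rabs (snd a) <= Cmod a.
Proof. eapply Rle_trans; [apply Rmax_r | apply (Complex.Rmax_Cmod a)]. Qed.
Lemma Cmod_le_parts a : Cmod a <= Rabs (fst a) + Rabs (snd a).
Proof.
replace a with (Cadd (fst a, 0) (0, snd a)) at 1
  by (destruct a; unfold Cadd; simpl; f_equal; ring).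
eapply Rle_trans; [apply Cmod_add |].
rewrite Cmod_real. apply Rplus_le_compat_l.
unfold Cmod; simpl. right.
replace (0 * (0 * 1) + snd a * (snd a * 1)) with (Rsqr (snd a)) by (unfold Rsqr; ring).
apply sqrt_Rsqr_abs.
Qed.

(** * Unconditional sums *)

Definition eq_dec_c {X : Type} (x y : X) : {x = y} + {x <> y} :=
  excluded_middle_informative (x = y).

(** Norm estimates are phrased as bounds on all finite partial sums: these make sense before
    convergence is known and are independent of the [epsilon] behind [Rsum]. *)
Definition ub {X : Type} (g : X -> R) (M : R) : Prop :=
  forall G : list X, NoDup G -> lsumR g G <= M.

Section Sums.
Context {X : Type}.
Implicit Types (f g h : X -> R) (F G : list X) (u v : X -> CC).

Lemma lsumR_app g F G : lsumR g (F ++ G) = lsumR g F + lsumR g G.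
Proof. induction F as [|x F IH]; simpl; [ring | rewrite IH; ring]. Qed.

Lemma lsumC_app u F G : lsumC u (F ++ G) = Cadd (lsumC u F) (lsumC u G).
Proof. induction F as [|x F IH]; simpl; [ring | rewrite IH; ring]. Qed.

Lemma lsumR_plus f g G : lsumR (fun x => f x + g x) G = lsumR f G + lsumR g G.
Proof. induction G as [|x G IH]; simpl; [ring | rewrite IH; ring]. Qed.

Lemma lsumR_scal c g G : lsumR (fun x => c * g x) G = c * lsumR g G.
Proof. induction G as [|x G IH]; simpl; [ring | rewrite IH; ring]. Qed.

Lemma lsumR_le f g G : (forall x, In x G -> f x <= g x) -> lsumR f G <= lsumR g G.
Proof.
induction G as [|x G IH]; simpl; intro H; [lra|].
apply Rplus_le_compat; auto.
Qed.

Lemma lsumR_ext f g G : (forall x, In x G -> f x = g x) -> lsumR f G = lsumR g G.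
Proof. induction G as [|x G IH]; simpl; intro H; [reflexivity|]. rewrite H, IH; auto. Qed.

Lemma lsumR_nonneg g G : (forall x, In x G -> 0 <= g x) -> 0 <= lsumR g G.
Proof.
induction G as [|x G IH]; simpl; intro H; [lra|].
apply Rplus_le_le_0_compat; auto.
Qed.

Lemma lsumR_const c G : lsumR (fun _ => c) G = INR (length G) * c.
Proof.
induction G as [|x G IH]; [simpl; ring|].
change (length (x :: G)) with (S (length G)). rewrite S_INR. simpl. rewrite IH. ring.
Qed.

Lemma lsumR_perm g F G : Permutation F G -> lsumR g F = lsumR g G.
Proof. induction 1; simpl; try lra; congruence. Qed.

Lemma lsumC_fst u G : fst (lsumC u G) = lsumR (fun x => fst (u x)) G.
Proof. induction G as [|x G IH]; simpl; [reflexivity | now rewrite IH]. Qed.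

Lemma lsumC_snd u G : snd (lsumC u G) = lsumR (fun x => snd (u x)) G.
Proof. induction G as [|x G IH]; simpl; [reflexivity | now rewrite IH]. Qed.

Lemma Cmod_lsumC u G : Cmod (lsumC u G) <= lsumR (fun x => Cmod (u x)) G.
Proof.
induction G as [|x G IH]; simpl; [rewrite Cmod_C0; lra|].
eapply Rle_trans; [apply Cmod_add | lra].
Qed.

Lemma NoDup_incl_split F G : NoDup F -> NoDup G -> incl F G ->
  exists H, Permutation G (F ++ H) /\ NoDup H /\ (forall x, In x H -> ~ In x F).
Proof.
intros HF HG HI.
set (inF := fun x => if in_dec eq_dec_c x F then true else false).
exists (filter (fun x => negb (inF x)) G). repeat split.
- apply NoDup_Permutation; auto.
  + apply NoDup_app; auto.
    * now apply NoDup_filter.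
    * intros x Hx Hx'. apply filter_In in Hx'. destruct Hx' as [_ Hx'].
      unfold inF in Hx'. destruct (in_dec eq_dec_c x F); [discriminate | tauto].
  + intro x. rewrite in_app_iff, filter_In. unfold inF.
    destruct (in_dec eq_dec_c x F) as [i|i]; simpl; split; intuition (auto; discriminate).
- now apply NoDup_filter.
- intros x Hx Hx'. apply filter_In in Hx. destruct Hx as [_ Hx]. unfold inF in Hx.
  destruct (in_dec eq_dec_c x F); [discriminate | tauto].
Qed.

Lemma lsumR_incl g F G : (forall x, 0 <= g x) -> NoDup F -> NoDup G -> incl F G ->
  lsumR g F <= lsumR g G.
Proof.
intros Hg HF HG HI. destruct (NoDup_incl_split F G HF HG HI) as [H [HP _]].
rewrite (lsumR_perm _ _ _ HP), lsumR_app.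
pose proof (lsumR_nonneg g H (fun x _ => Hg x)). lra.
Qed.

Lemma ub_le f g M : (forall x, f x <= g x) -> ub g M -> ub f M.
Proof.
intros H HM G HG. eapply Rle_trans; [apply (lsumR_le f g); auto | now apply HM].
Qed.

Lemma ub_weaken g M M' : ub g M -> M <= M' -> ub g M'.
Proof. intros H HM G HG. pose proof (H G HG). lra. Qed.

Lemma ub_plus f g M M' : ub f M -> ub g M' -> ub (fun x => f x + g x) (M + M').
Proof. intros H H' G HG. rewrite lsumR_plus. pose proof (H G HG); pose proof (H' G HG); lra. Qed.

Lemma ub_scal c g M : 0 <= c -> ub g M -> ub (fun x => c * g x) (c * M).
Proof. intros Hc H G HG. rewrite lsumR_scal. apply Rmult_le_compat_l; auto. Qed.

Lemma ub_term g M x : ub g M -> g x <= M.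
Proof.
intro H. assert (HN : NoDup [x]) by (constructor; [easy | constructor]).
pose proof (H [x] HN) as E. simpl in E. lra.
Qed.

Lemma ub_single (x0 : X) (v : R) : 0 <= v -> ub (fun x => if eq_dec_c x0 x then v else 0) v.
Proof.
intros Hv.
assert (E : forall L, ~ In x0 L -> lsumR (fun x => if eq_dec_c x0 x then v else 0) L = 0).
{ induction L as [|x L IH]; simpl; intro H; [reflexivity|].
  rewrite IH by tauto. destruct (eq_dec_c x0 x); [|ring]. elim H; auto. }
intros G HG. induction HG as [|x G Hx HG IH]; simpl; auto.
destruct (eq_dec_c x0 x) as [<-|Hn]; [rewrite E by auto|]; lra.
Qed.

(** For nonnegative terms finite sums grow with the index set, so their supremum is the
    unconditional sum. *)
Lemma ub_has_sumR g M : (forall x, 0 <= g x) -> ub g M ->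
  exists s, has_sumR g s /\ ub g s /\ s <= M.
Proof.
intros Hg HM.
destruct (completeness (fun y => exists G, NoDup G /\ y = lsumR g G)) as [s [Hs1 Hs2]].
- exists M. intros y [G [HG ->]]. now apply HM.
- exists 0, []. split; [constructor | reflexivity].
- assert (Hub : ub g s) by (intros G HG; apply Hs1; eauto).
  exists s. repeat split; auto.
  + intros eps He.
    destruct (classic (exists F, NoDup F /\ s - eps < lsumR g F)) as [[F [HF HF']]|HN].
    * exists F. intros G HG HI. pose proof (Hub G HG).
      pose proof (lsumR_incl g F G Hg HF HG HI). apply Rabs_def1; lra.
    * exfalso. assert (s <= s - eps); [|lra].
      apply Hs2. intros y [G [HG ->]]. apply Rnot_lt_le. intro. apply HN. eauto.
  + apply Hs2. intros y [G [HG ->]]. now apply HM.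
Qed.

Lemma nodup_c G : exists G', NoDup G' /\ (forall x, In x G <-> In x G').
Proof.
exists (nodup eq_dec_c G). split; [apply NoDup_nodup | intro; now rewrite nodup_In].
Qed.

Lemma has_sumR_common g h s s' : has_sumR g s -> has_sumR h s' ->
  forall eps, 0 < eps -> exists F, NoDup F /\ forall G, NoDup G -> incl F G ->
    Rabs (lsumR g G - s) < eps /\ Rabs (lsumR h G - s') < eps.
Proof.
intros H H' eps He. destruct (H eps He) as [F HF]; destruct (H' eps He) as [F' HF'].
destruct (nodup_c (F ++ F')) as [K [HK HI]].
exists K. split; auto. intros G HG HKG. split; [apply HF | apply HF']; auto;
  intros x Hx; apply HKG, HI, in_app_iff; auto.
Qed.

Lemma has_sumR_unique g s s' : has_sumR g s -> has_sumR g s' -> s = s'.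
Proof.
intros H H'.
destruct (Req_dec s s') as [|Hn]; [lra|].
assert (0 < Rabs (s - s')) by (apply Rabs_pos_lt; lra).
destruct (has_sumR_common g g s s' H H' (Rabs (s - s') / 2) ltac:(lra)) as [F [HF HH]].
destruct (HH F HF (incl_refl _)) as [H1 H2].
pose proof (Rabs_triang (s - lsumR g F) (lsumR g F - s')) as T.
replace (s - lsumR g F + (lsumR g F - s')) with (s - s') in T by ring.
rewrite (Rabs_minus_sym s (lsumR g F)) in T. lra.
Qed.

Lemma Rsum_eq g s : has_sumR g s -> Rsum g = s.
Proof.
intro H. apply (has_sumR_unique g); auto.
unfold Rsum. apply epsilon_spec. eauto.
Qed.

Lemma Rsum_ub g M : (forall x, 0 <= g x) -> ub g M -> ub g (Rsum g) /\ Rsum g <= M.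
Proof.
intros Hg HM. destruct (ub_has_sumR g M Hg HM) as [s [H1 [H2 H3]]].
rewrite (Rsum_eq g s H1). auto.
Qed.

Lemma has_sumR_plus g h s s' : has_sumR g s -> has_sumR h s' ->
  has_sumR (fun x => g x + h x) (s + s').
Proof.
intros H H' eps He.
destruct (has_sumR_common g h s s' H H' (eps / 2) ltac:(lra)) as [F [HF HH]].
exists F. intros G HG HI. destruct (HH G HG HI) as [H1 H2]. rewrite lsumR_plus.
replace (lsumR g G + lsumR h G - (s + s')) with ((lsumR g G - s) + (lsumR h G - s')) by ring.
eapply Rle_lt_trans; [apply Rabs_triang | lra].
Qed.

Lemma has_sumR_scal c g s : has_sumR g s -> has_sumR (fun x => c * g x) (c * s).
Proof.
intros H eps He.
destruct (H (eps / (Rabs c + 1))) as [F HF].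
{ apply Rdiv_lt_0_compat; auto. pose proof (Rabs_pos c); lra. }
exists F. intros G HG HI. specialize (HF G HG HI). rewrite lsumR_scal.
replace (c * lsumR g G - c * s) with (c * (lsumR g G - s)) by ring.
rewrite Rabs_mult. pose proof (Rabs_pos c).
apply (Rmult_lt_compat_l (Rabs c + 1)) in HF; [|lra].
replace ((Rabs c + 1) * (eps / (Rabs c + 1))) with eps in HF by (field; lra).
pose proof (Rabs_pos (lsumR g G - s)). nra.
Qed.

Lemma has_sumR_ext g h s : (forall x, g x = h x) -> has_sumR g s -> has_sumR h s.
Proof.
intros H. replace h with g; auto. extensionality x; auto.
Qed.

(** Positive and negative parts are both bounded by the absolute value and are summed separately. *)
Lemma ub_abs_has_sumR g M : ub (fun x => Rabs (g x)) M -> exists s, has_sumR g s.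
Proof.
intro H.
destruct (ub_has_sumR (fun x => Rmax (g x) 0) M) as [s [H1 _]].
{ intro; apply Rmax_r. }
{ eapply ub_le; [|exact H]. intro x; simpl. apply Rmax_lub; [apply Rle_abs | apply Rabs_pos]. }
destruct (ub_has_sumR (fun x => Rmax (- g x) 0) M) as [s' [H2 _]].
{ intro; apply Rmax_r. }
{ eapply ub_le; [|exact H]. intro x; simpl. rewrite <- Rabs_Ropp.
  apply Rmax_lub; [apply Rle_abs | apply Rabs_pos]. }
exists (s + (-1) * s').
eapply has_sumR_ext; [|apply (has_sumR_plus _ _ _ _ H1 (has_sumR_scal (-1) _ _ H2))].
intro x; simpl. unfold Rmax. destruct (Rle_dec (g x) 0), (Rle_dec (- g x) 0); lra.
Qed.

Lemma has_sumC_parts u s : has_sumC u s <->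
  has_sumR (fun x => fst (u x)) (fst s) /\ has_sumR (fun x => snd (u x)) (snd s).
Proof.
split.
- intro H; split; intros eps He; destruct (H eps He) as [F HF]; exists F; intros G HG HI;
    (eapply Rle_lt_trans; [|apply (HF G HG HI)]).
  + rewrite <- lsumC_fst. apply (fst_le_Cmod (Csub (lsumC u G) s)).
  + rewrite <- lsumC_snd. apply (snd_le_Cmod (Csub (lsumC u G) s)).
- intros [H H'] eps He.
  destruct (has_sumR_common _ _ _ _ H H' (eps / 2) ltac:(lra)) as [F [HF HH]].
  exists F. intros G HG HI. destruct (HH G HG HI) as [H1 H2].
  eapply Rle_lt_trans; [apply Cmod_le_parts|]. simpl. rewrite lsumC_fst, lsumC_snd.
  unfold Rminus in H1, H2. lra.
Qed.

Lemma Csum_eq u s : has_sumC u s -> Csum u = s.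
Proof.
intro H.
assert (H' : has_sumC u (Csum u)) by (unfold Csum; apply epsilon_spec; eauto).
apply has_sumC_parts in H, H'. destruct H, H'.
apply injective_projections; eapply has_sumR_unique; eauto.
Qed.

Lemma Csum_spec u M : ub (fun x => Cmod (u x)) M -> has_sumC u (Csum u).
Proof.
intro H. unfold Csum. apply epsilon_spec.
destruct (ub_abs_has_sumR (fun x => fst (u x)) M) as [s H1].
{ eapply ub_le; [|exact H]; intro; apply fst_le_Cmod. }
destruct (ub_abs_has_sumR (fun x => snd (u x)) M) as [s' H2].
{ eapply ub_le; [|exact H]; intro; apply snd_le_Cmod. }
exists (s, s'). apply has_sumC_parts; auto.
Qed.

Lemma has_sumC_add u v s s' : has_sumC u s -> has_sumC v s' ->
  has_sumC (fun x => Cadd (u x) (v x)) (Cadd s s').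
Proof.
rewrite !has_sumC_parts. intros [H1 H2] [H3 H4].
split; simpl; now apply has_sumR_plus.
Qed.

Lemma has_sumC_scale c u s : has_sumC u s -> has_sumC (fun x => Cmul c (u x)) (Cmul c s).
Proof.
rewrite !has_sumC_parts. intros [H1 H2]; simpl; split.
- replace (fst c * fst s - snd c * snd s) with (fst c * fst s + - snd c * snd s) by ring.
  eapply has_sumR_ext; [|eapply has_sumR_plus;
    [apply (has_sumR_scal (fst c) _ _ H1) | apply (has_sumR_scal (- snd c) _ _ H2)]].
  intro; simpl; ring.
- eapply has_sumR_ext; [|eapply has_sumR_plus;
    [apply (has_sumR_scal (fst c) _ _ H2) | apply (has_sumR_scal (snd c) _ _ H1)]].
  intro; simpl; ring.
Qed.

Lemma has_sumC_single u x0 : (forall x, x <> x0 -> u x = C0) -> has_sumC u (u x0).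
Proof.
intros H eps He. exists [x0]. intros G HG HI.
assert (HN : NoDup [x0]) by (constructor; [easy | constructor]).
destruct (NoDup_incl_split [x0] G HN HG HI) as [K [HP [_ HK]]].
assert (E : lsumC u G = u x0).
{ apply injective_projections; [rewrite lsumC_fst | rewrite lsumC_snd];
    rewrite (lsumR_perm _ _ _ HP), lsumR_app; simpl;
    rewrite (lsumR_ext _ (fun _ => 0 * 0) K), lsumR_scal; try ring;
    intros y Hy; rewrite H; simpl; try ring; intro E; apply (HK y Hy); simpl; auto. }
rewrite E. replace (Csub (u x0) (u x0)) with C0 by ring. now rewrite Cmod_C0.
Qed.

(** Supplies the finite fibres that [ub_fiber] asks for when a product is estimated. *)
Lemma has_sumC_finite_approx u s : has_sumC u s -> forall eps, 0 < eps ->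
  exists F, NoDup F /\ Cmod s <= lsumR (fun x => Cmod (u x)) F + eps.
Proof.
intros H eps He. destruct (H eps He) as [F HF].
destruct (nodup_c F) as [K [HK HI]]. exists K. split; auto.
specialize (HF K HK (fun x Hx => proj1 (HI x) Hx)).
replace s with (Cadd (lsumC u K) (Csub s (lsumC u K))) by ring.
eapply Rle_trans; [apply Cmod_add|]. rewrite (Cmod_sub_sym s).
pose proof (Cmod_lsumC u K). lra.
Qed.

End Sums.

Lemma lsumR_map {X Y : Type} (g : Y -> R) (h : X -> Y) G :
  lsumR g (map h G) = lsumR (fun x => g (h x)) G.
Proof. induction G as [|x G IH]; simpl; [reflexivity | now rewrite IH]. Qed.

Lemma NoDup_list_prod {X Y : Type} (F : list X) (G : list Y) :
  NoDup F -> NoDup G -> NoDup (list_prod F G).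
Proof.
intros HF HG. induction HF as [|x F Hx HF IH]; simpl; [constructor|].
apply NoDup_app; auto.
- apply FinFun.Injective_map_NoDup; auto. intros y y' E. congruence.
- intros [a b] Ha Hb. apply in_map_iff in Ha. destruct Ha as [y [E _]].
  apply in_prod_iff in Hb. destruct Hb as [Hb _]. congruence.
Qed.

(** A finite set of pairs lies in the rectangle spanned by its two projections, over which the sum
    factors. *)
Lemma ub_prod {X Y : Type} (g : X -> R) (h : Y -> R) M M' :
  (forall x, 0 <= g x) -> (forall y, 0 <= h y) -> ub g M -> ub h M' ->
  ub (fun p : X * Y => g (fst p) * h (snd p)) (M * M').
Proof.
intros Hg Hh HM HM' G HG.
destruct (nodup_c (map fst G)) as [F [HF HFi]].
destruct (nodup_c (map snd G)) as [F' [HF' HFi']].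
apply Rle_trans with (lsumR g F * lsumR h F').
- apply Rle_trans with (lsumR (fun p : X * Y => g (fst p) * h (snd p)) (list_prod F F')).
  + apply lsumR_incl; auto.
    * intro; apply Rmult_le_pos; auto.
    * now apply NoDup_list_prod.
    * intros [x y] Hp. apply in_prod_iff. split.
      { apply HFi. change x with (fst (x, y)). now apply in_map. }
      { apply HFi'. change y with (snd (x, y)). now apply in_map. }
  + right. clear HF HFi. induction F as [|x F IH]; simpl; [ring|].
    rewrite lsumR_app, lsumR_map, IH. simpl. rewrite (lsumR_scal (g x)). ring.
- apply Rmult_le_compat; auto; apply lsumR_nonneg; auto.
Qed.

(* Each fibre sum is replaced by a finite one up to an error, and the finite
   fibres of distinct points are disjoint. *)
Lemma ub_fiber {X Y : Type} (c : Y -> R) (p : X -> Y) (h : X -> R) M :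
  ub h M ->
  (forall y eps, 0 < eps -> exists F, NoDup F /\ (forall x, In x F -> p x = y) /\
     c y <= lsumR h F + eps) ->
  ub c M.
Proof.
intros HM Hf G HG.
assert (K : forall eps, 0 < eps -> exists L, NoDup L /\ (forall x, In x L -> In (p x) G) /\
  lsumR c G <= lsumR h L + eps).
{ clear HM. induction G as [|y G IH]; intros eps He.
  - exists []. split; [constructor|]. split; [easy | simpl; lra].
  - apply NoDup_cons_iff in HG. destruct HG as [Hy HG].
    destruct (IH HG (eps / 2) ltac:(lra)) as [L [HL [HL1 HL2]]].
    destruct (Hf y (eps / 2) ltac:(lra)) as [F [HF [HF1 HF2]]].
    exists (F ++ L). split; [|split].
    + apply NoDup_app; auto. intros x Hx Hx'. apply Hy.
      rewrite <- (HF1 x Hx). auto.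
    + intros x Hx. apply in_app_iff in Hx. simpl. destruct Hx; [left; symmetry|right]; auto.
    + rewrite lsumR_app. simpl. lra. }
apply Rnot_lt_le; intro HL.
destruct (K ((lsumR c G - M) / 2) ltac:(lra)) as [L [HL1 [_ HL2]]].
pose proof (HM L HL1). lra.
Qed.

Lemma lsumR_cv {X : Type} (g : nat -> X -> R) (g' : X -> R) G :
  (forall x, Un_cv (fun m => g m x) (g' x)) ->
  Un_cv (fun m => lsumR (g m) G) (lsumR g' G).
Proof.
intro H. induction G as [|x G IH]; simpl.
- intros eps He. exists 0%nat. intros. unfold Rdist. rewrite Rminus_diag, Rabs_R0. lra.
- apply CV_plus; auto.
Qed.

(** One positive weight already controls each coefficient, so coefficientwise limits exist and are
    the same for all weights in [W]; the Cauchy bound then passes to the limit on each finite set.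
    Used both for the algebra itself and for entire series on words. *)
Lemma l1_complete {X : Type} (x : nat -> X -> CC) (W : (X -> R) -> Prop) :
  (forall w k, W w -> 0 < w k) -> (exists w, W w) ->
  (forall w, W w -> forall eps, 0 < eps -> exists M, forall m p, (M <= m)%nat -> (M <= p)%nat ->
     ub (fun k => Cmod (Csub (x m k) (x p k)) * w k) eps) ->
  exists y : X -> CC, forall w, W w -> forall eps, 0 < eps -> exists M, forall m, (M <= m)%nat ->
     ub (fun k => Cmod (Csub (x m k) (y k)) * w k) eps.
Proof.
intros Wpos [w0 Hw0] HC.
assert (Hpt : forall k eps, 0 < eps -> exists M, forall m p, (M <= m)%nat -> (M <= p)%nat ->
   Cmod (Csub (x m k) (x p k)) < eps).
{ intros k eps He. pose proof (Wpos w0 k Hw0) as Hp.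
  destruct (HC w0 Hw0 (eps * w0 k / 2)) as [M HM].
  { apply Rdiv_lt_0_compat; [apply Rmult_lt_0_compat|]; lra. }
  exists M. intros m p Hm Hpp. pose proof (ub_term _ _ k (HM m p Hm Hpp)) as T. simpl in T.
  apply (Rmult_lt_reg_r (w0 k)); auto.
  assert (0 < eps * w0 k) by (apply Rmult_lt_0_compat; lra). lra. }
assert (Hcv : forall k, exists s : CC, Un_cv (fun m => fst (x m k)) (fst s) /\
   Un_cv (fun m => snd (x m k)) (snd s)).
{ intro k.
  destruct (R_complete (fun m => fst (x m k))) as [s1 H1].
  { intros eps He. destruct (Hpt k eps He) as [M HM]. exists M. intros m p Hm Hp. unfold Rdist.
    eapply Rle_lt_trans; [|apply (HM m p Hm Hp)].
    apply (fst_le_Cmod (Csub (x m k) (x p k))). }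
  destruct (R_complete (fun m => snd (x m k))) as [s2 H2].
  { intros eps He. destruct (Hpt k eps He) as [M HM]. exists M. intros m p Hm Hp. unfold Rdist.
    eapply Rle_lt_trans; [|apply (HM m p Hm Hp)].
    apply (snd_le_Cmod (Csub (x m k) (x p k))). }
  exists (s1, s2). auto. }
destruct (choice _ Hcv) as [y Hy]. exists y.
intros w Hw eps He. destruct (HC w Hw eps He) as [M HM]. exists M. intros m Hm G HG.
(* The index is shifted by [M] so that every term of the sequence in [p] obeys the Cauchy bound. *)
assert (L : Un_cv (fun p => lsumR (fun k => Cmod (Csub (x m k) (x (M + p)%nat k)) * w k) G)
              (lsumR (fun k => Cmod (Csub (x m k) (y k)) * w k) G)).
{ apply lsumR_cv. intro k. destruct (Hy k) as [Hy1 Hy2]. intros e Hee.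
  pose proof (Wpos w k Hw) as Hp.
  destruct (Hy1 (e / w k / 2)) as [M1 HM1]. { apply Rdiv_lt_0_compat; [apply Rdiv_lt_0_compat|]; lra. }
  destruct (Hy2 (e / w k / 2)) as [M2 HM2]. { apply Rdiv_lt_0_compat; [apply Rdiv_lt_0_compat|]; lra. }
  exists (M1 + M2)%nat. intros p Hpp.
  specialize (HM1 (M + p)%nat ltac:(lia)). specialize (HM2 (M + p)%nat ltac:(lia)).
  unfold Rdist in *.
  rewrite <- Rmult_minus_distr_r, Rabs_mult, (Rabs_right (w k)) by lra.
  assert (T : Rabs (Cmod (Csub (x m k) (x (M + p)%nat k)) - Cmod (Csub (x m k) (y k))) < e / w k).
  { eapply Rle_lt_trans with (Cmod (Csub (x (M + p)%nat k) (y k))).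
    - pose proof (Cmod_add (Csub (x m k) (x (M + p)%nat k)) (Csub (x (M + p)%nat k) (y k))) as T1.
      pose proof (Cmod_add (Csub (x m k) (y k)) (Csub (y k) (x (M + p)%nat k))) as T2.
      rewrite (Cmod_sub_sym (y k)) in T2.
      replace (Cadd (Csub (x m k) (x (M + p)%nat k)) (Csub (x (M + p)%nat k) (y k)))
        with (Csub (x m k) (y k)) in T1 by ring.
      replace (Cadd (Csub (x m k) (y k)) (Csub (y k) (x (M + p)%nat k)))
        with (Csub (x m k) (x (M + p)%nat k)) in T2 by ring.
      apply Rabs_le; lra.
    - eapply Rle_lt_trans; [apply Cmod_le_parts|]. simpl. unfold Rminus in *. lra. }
  apply (Rmult_lt_compat_r (w k)) in T; auto.
  replace (e / w k * w k) with e in T by (field; lra). exact T. }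
apply Rnot_lt_le; intro HL.
destruct (L (lsumR (fun k => Cmod (Csub (x m k) (y k)) * w k) G - eps) ltac:(lra)) as [p0 Hp0].
specialize (Hp0 p0 (Nat.le_refl _)). unfold Rdist in Hp0.
pose proof (HM m (M + p0)%nat Hm ltac:(lia) G HG) as T. simpl in T.
apply Rabs_def2 in Hp0. lra.
Qed.

(** * Weights *)

Definition wfac (x y : R) (z : Z) : R := if Z.ltb z 0 then powerRZ x z else powerRZ y z.

Lemma powerRZ_le_pos x y z : 0 < x -> x <= y -> (0 <= z)%Z -> powerRZ x z <= powerRZ y z.
Proof.
intros Hx Hy Hz. rewrite <- (Z2Nat.id z Hz), <- !pow_powerRZ. apply pow_incr; lra.
Qed.

Lemma powerRZ_le_neg x y z : 0 < x -> x <= y -> (z <= 0)%Z -> powerRZ y z <= powerRZ x z.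
Proof.
intros Hx Hy Hz. replace z with (- (- z))%Z by lia. rewrite !(powerRZ_neg' _ (- z)).
apply Rinv_le_contravar; [apply powerRZ_lt; auto | apply powerRZ_le_pos; auto; lia].
Qed.

Lemma wfac_pos x y z : 0 < x -> x <= y -> 0 < wfac x y z.
Proof. intros; unfold wfac; destruct (Z.ltb z 0); apply powerRZ_lt; lra. Qed.

Lemma wfac_le x y x' y' z : 0 < x' -> x' <= x -> 0 < y -> y <= y' -> wfac x y z <= wfac x' y' z.
Proof.
intros; unfold wfac. destruct (Z.ltb_spec z 0).
- apply powerRZ_le_neg; lia || lra.
- apply powerRZ_le_pos; lia || lra.
Qed.

(** Only exponents of opposite sign lose anything: one factor is then taken at the other radius, and
    [x <= y] gives the inequality its direction. *)
Lemma wfac_add x y a b : 0 < x -> x <= y -> wfac x y (a + b) <= wfac x y a * wfac x y b.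
Proof.
intros Hx Hy. unfold wfac.
assert (Px : forall z, 0 < powerRZ x z) by (intro; apply powerRZ_lt; lra).
assert (Py : forall z, 0 < powerRZ y z) by (intro; apply powerRZ_lt; lra).
assert (Ax : powerRZ x (a + b) = powerRZ x a * powerRZ x b) by (apply powerRZ_add; lra).
assert (Ay : powerRZ y (a + b) = powerRZ y a * powerRZ y b) by (apply powerRZ_add; lra).
destruct (Z.ltb_spec a 0), (Z.ltb_spec b 0), (Z.ltb_spec (a + b) 0); try lia;
  rewrite ?Ax, ?Ay; try lra.
- apply Rmult_le_compat_l; [apply Rlt_le, Px | apply powerRZ_le_pos; auto].
- apply Rmult_le_compat_r; [apply Rlt_le, Py | apply powerRZ_le_neg; auto; lia].
- apply Rmult_le_compat_r; [apply Rlt_le, Px | apply powerRZ_le_pos; auto].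
- apply Rmult_le_compat_l; [apply Rlt_le, Py | apply powerRZ_le_neg; auto; lia].
Qed.

Definition lprod (L : list R) : R := fold_right Rmult 1 L.

Lemma lprod_pos {X : Type} (f : X -> R) L : (forall x, In x L -> 0 < f x) -> 0 < lprod (map f L).
Proof.
induction L as [|x L IH]; simpl; intro H; [lra|]. apply Rmult_lt_0_compat; auto.
Qed.

Lemma lprod_le {X : Type} (f g : X -> R) L : (forall x, In x L -> 0 < f x <= g x) ->
  lprod (map f L) <= lprod (map g L).
Proof.
induction L as [|x L IH]; simpl; intro H; [lra|].
apply Rmult_le_compat; try (apply H; auto).
- apply Rlt_le, H; auto.
- apply Rlt_le, lprod_pos. intros; apply H; auto.
- apply IH; auto.
Qed.

Lemma lprod_mult {X : Type} (f g : X -> R) L :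
  lprod (map (fun x => f x * g x) L) = lprod (map f L) * lprod (map g L).
Proof. induction L as [|x L IH]; simpl; [ring | rewrite IH; ring]. Qed.

Definition radii (n : nat) (rho tau : nat -> R) : Prop :=
  forall i, (i < n)%nat -> 0 < rho i /\ rho i <= tau i.

Lemma weight_lprod n rho tau k :
  weight n rho tau k = lprod (map (fun i => wfac (rho i) (tau i) (kcoord k i)) (seq 0 n)).
Proof. reflexivity. Qed.

Lemma weight_pos n rho tau k : radii n rho tau -> 0 < weight n rho tau k.
Proof.
intro H. rewrite weight_lprod. apply lprod_pos. intros i Hi. apply in_seq in Hi.
destruct (H i ltac:(lia)). now apply wfac_pos.
Qed.

Lemma weight_le n rho tau rho' tau' k : radii n rho tau ->
  (forall i, (i < n)%nat -> 0 < rho' i /\ rho' i <= rho i /\ tau i <= tau' i) ->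
  weight n rho tau k <= weight n rho' tau' k.
Proof.
intros H H'. rewrite !weight_lprod. apply lprod_le. intros i Hi. apply in_seq in Hi.
destruct (H i ltac:(lia)). destruct (H' i ltac:(lia)) as [? []].
split; [apply wfac_pos | apply wfac_le]; auto; lra.
Qed.

Lemma kcoord_map_seq n (f : nat -> Z) i : (i < n)%nat -> kcoord (map f (seq 0 n)) i = f i.
Proof.
intro Hi. unfold kcoord. rewrite (nth_indep _ 0%Z (f 0%nat)) by (now rewrite length_map, length_seq).
rewrite map_nth, seq_nth; auto.
Qed.

Lemma mindex_ext n k l : length k = n -> length l = n ->
  (forall i, (i < n)%nat -> kcoord k i = kcoord l i) -> k = l.
Proof.
intros Hk Hl H. apply (nth_ext _ _ 0%Z 0%Z); [congruence|]. intros i Hi. apply H; lia.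
Qed.

Definition vadd (n : nat) (k l : mindex) : mindex :=
  map (fun i => (kcoord k i + kcoord l i)%Z) (seq 0 n).

Lemma length_vadd n k l : length (vadd n k l) = n.
Proof. unfold vadd; now rewrite length_map, length_seq. Qed.

Lemma length_vsub n k l : length (vsub n k l) = n.
Proof. unfold vsub; now rewrite length_map, length_seq. Qed.

Lemma kcoord_vadd n k l i : (i < n)%nat -> kcoord (vadd n k l) i = (kcoord k i + kcoord l i)%Z.
Proof. intro; unfold vadd; now rewrite kcoord_map_seq. Qed.

Lemma kcoord_vsub n k l i : (i < n)%nat -> kcoord (vsub n k l) i = (kcoord k i - kcoord l i)%Z.
Proof. intro; unfold vsub; now rewrite kcoord_map_seq. Qed.

Lemma vadd_vsub n m k : length m = n -> vadd n k (vsub n m k) = m.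
Proof.
intro H. apply (mindex_ext n); auto using length_vadd.
intros i Hi. rewrite kcoord_vadd, kcoord_vsub by auto. lia.
Qed.

Lemma vsub_vadd n k l : length l = n -> vsub n (vadd n k l) k = l.
Proof.
intro H. apply (mindex_ext n); auto using length_vsub.
intros i Hi. rewrite kcoord_vsub, kcoord_vadd by auto. lia.
Qed.

Lemma length_zero n : length (zero_index n) = n.
Proof. apply repeat_length. Qed.

Lemma kcoord_zero n i : kcoord (zero_index n) i = 0%Z.
Proof. unfold kcoord, zero_index. apply nth_repeat. Qed.

Lemma vadd_zero_r n k : length k = n -> vadd n k (zero_index n) = k.
Proof.
intro H. apply (mindex_ext n); auto using length_vadd.
intros i Hi. rewrite kcoord_vadd, kcoord_zero by auto. lia.
Qed.

Lemma weight_vadd n rho tau k l : radii n rho tau ->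
  weight n rho tau (vadd n k l) <= weight n rho tau k * weight n rho tau l.
Proof.
intro H. rewrite !weight_lprod, <- lprod_mult. apply lprod_le. intros i Hi. apply in_seq in Hi.
destruct (H i ltac:(lia)). rewrite kcoord_vadd by lia.
split; [apply wfac_pos | apply wfac_add]; auto.
Qed.

Lemma weight_zero n rho tau : weight n rho tau (zero_index n) = 1.
Proof.
rewrite weight_lprod. induction (seq 0 n) as [|i L IH]; simpl; [reflexivity|].
rewrite IH, kcoord_zero. unfold wfac; simpl. ring.
Qed.

(** * The weighted norms and the product *)

Definition nle (n : nat) (rho tau : nat -> R) (a : coef) (M : R) : Prop :=
  ub (fun k => Cmod (a k) * weight n rho tau k) M.

Definition mono (k : mindex) : coef := fun m => if list_eq_dec Z.eq_dec m k then C1 else C0.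

Definition czero : coef := fun _ => C0.

Lemma lsumA_cons {X : Type} (F : X -> coef) x G : lsumA F (x :: G) = cadd (F x) (lsumA F G).
Proof. reflexivity. Qed.

Section Norm.
Context (n : nat) (rho tau : nat -> R).
Hypothesis Hrad : radii n rho tau.
Notation nl := (nle n rho tau).
Notation w := (weight n rho tau).

Let wpos k : 0 < w k := weight_pos n rho tau k Hrad.

Lemma nterm_nonneg (a : coef) k : 0 <= Cmod (a k) * w k.
Proof. apply Rmult_le_pos; [apply Cmod_nonneg | apply Rlt_le, wpos]. Qed.

Lemma nle_cnorm a M : nl a M -> nl a (cnorm n rho tau a) /\ cnorm n rho tau a <= M.
Proof. intro H. apply Rsum_ub; auto. intro; apply nterm_nonneg. Qed.

Lemma nle_weaken a M M' : nl a M -> M <= M' -> nl a M'.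
Proof. apply ub_weaken. Qed.

Lemma nle_add a b M M' : nl a M -> nl b M' -> nl (cadd a b) (M + M').
Proof.
intros H H'. eapply ub_le; [|exact (ub_plus _ _ _ _ H H')].
intro k; unfold cadd; simpl. rewrite <- Rmult_plus_distr_r.
apply Rmult_le_compat_r; [apply Rlt_le, wpos | apply Cmod_add].
Qed.

Lemma nle_sub a b M M' : nl a M -> nl b M' -> nl (csub a b) (M + M').
Proof.
intros H H'. eapply ub_le; [|exact (ub_plus _ _ _ _ H H')].
intro k; unfold csub; simpl. rewrite <- Rmult_plus_distr_r.
apply Rmult_le_compat_r; [apply Rlt_le, wpos|].
rewrite <- (Cmod_neg (b k)). apply Cmod_add.
Qed.

Lemma nle_scale c a M : nl a M -> nl (cscale c a) (Cmod c * M).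
Proof.
intros H. eapply ub_le; [|exact (ub_scal (Cmod c) _ _ (Cmod_nonneg c) H)].
intro k; unfold cscale; simpl. rewrite Cmod_Cmul. lra.
Qed.

Lemma nle_sym a b M : nl (csub a b) M -> nl (csub b a) M.
Proof. apply ub_le. intro k. unfold csub. rewrite Cmod_sub_sym. lra. Qed.

Lemma nle_zero M : 0 <= M -> nl czero M.
Proof.
intros HM G HG. rewrite (lsumR_ext _ (fun _ => 0 * 0)).
- rewrite lsumR_scal. lra.
- intros; unfold czero. rewrite Cmod_C0; ring.
Qed.

Lemma nle_mono k : nl (mono k) (w k).
Proof.
eapply ub_le; [|exact (ub_single k (w k) (Rlt_le _ _ (wpos k)))].
intro m. unfold mono. simpl.
destruct (list_eq_dec Z.eq_dec m k) as [Hm|Hm], (eq_dec_c k m) as [E|E]; try congruence.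
- rewrite Hm, Cmod_C1. lra.
- rewrite Cmod_C0. lra.
Qed.

Lemma nle_triangle a b c M M' : nl (csub a b) M -> nl (csub b c) M' -> nl (csub a c) (M + M').
Proof.
intros H H'. pose proof (nle_add _ _ _ _ H H') as T. eapply ub_le; [|exact T].
intro k; unfold csub, cadd; simpl. right; f_equal; f_equal. ring.
Qed.

Lemma nle_lsumA {X : Type} (F : X -> coef) (M : X -> R) (G : list X) :
  (forall x, In x G -> nl (F x) (M x)) -> nl (lsumA F G) (lsumR M G).
Proof.
induction G as [|x G IH]; simpl; intro H; [apply nle_zero; lra|].
apply nle_add; auto.
Qed.

(** [F] is taken with partial sum within [eps] of the supremum; a finite set disjoint from [F] can
    then add at most [eps]. *)
Lemma nle_approx a M : nl a M -> forall eps, 0 < eps -> exists F, NoDup F /\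
  nl (csub a (lsumA (fun k => cscale (a k) (mono k)) F)) eps.
Proof.
intros H eps He.
destruct (ub_has_sumR _ _ (nterm_nonneg a) H) as [s [Hs [Hs1 Hs2]]].
destruct (Hs eps He) as [F0 HF0].
destruct (nodup_c F0) as [F [HF HI]]. exists F. split; auto.
assert (E : forall k L, NoDup L -> lsumA (fun k => cscale (a k) (mono k)) L k =
   if in_dec eq_dec_c k L then a k else C0).
{ intros k L HL. induction HL as [|x L Hx HL IH]; [reflexivity|].
  rewrite lsumA_cons. unfold cadd, cscale at 1, mono at 1. rewrite IH. simpl.
  destruct (list_eq_dec Z.eq_dec k x) as [->|Hn].
  - destruct (eq_dec_c x x); [|congruence].
    destruct (in_dec eq_dec_c x L); [tauto | ring].
  - destruct (eq_dec_c x k); [congruence|]. destruct (in_dec eq_dec_c k L); ring. }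
intros G HG.
set (P := fun k => if in_dec eq_dec_c k F then false else true).
assert (E2 : lsumR (fun k => Cmod (csub a (lsumA (fun k => cscale (a k) (mono k)) F) k) * w k) G
   = lsumR (fun k => Cmod (a k) * w k) (filter P G)).
{ clear HG. induction G as [|k G IH]; simpl; [reflexivity|].
  rewrite IH. unfold csub at 1. rewrite E by auto. unfold P at 2.
  destruct (in_dec eq_dec_c k F); simpl.
  - replace (Csub (a k) (a k)) with C0 by ring. rewrite Cmod_C0; ring.
  - replace (Csub (a k) C0) with (a k) by ring. reflexivity. }
rewrite E2.
assert (HN : NoDup (F ++ filter P G)).
{ apply NoDup_app; auto. { now apply NoDup_filter. }
  intros k Hk Hk'. apply filter_In in Hk'. unfold P in Hk'.
  destruct (in_dec eq_dec_c k F); [now destruct Hk' | tauto]. }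
pose proof (Hs1 _ HN) as T. rewrite lsumR_app in T.
assert (HF1 : incl F0 F) by (intros k; apply HI).
pose proof (HF0 F HF HF1) as T2. apply Rabs_def2 in T2. lra.
Qed.

Section Product.
Context (q : nat -> nat -> CC).
Hypothesis hqabs : forall i j, (i < n)%nat -> (j < n)%nat -> Cmod (q i j) = 1.

Lemma Cmod_Cpow_unit c m : Cmod c = 1 -> Cmod (Cpow c m) = 1.
Proof. intro H. induction m; simpl; [apply Cmod_C1 | rewrite Cmod_Cmul, H, IHm; ring]. Qed.

Lemma Cmod_Cpowz_unit c z : Cmod c = 1 -> Cmod (Cpowz c z) = 1.
Proof.
intro H. destruct z; simpl; [apply Cmod_C1 | now apply Cmod_Cpow_unit |].
now apply Cmod_inv_unit, Cmod_Cpow_unit.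
Qed.

Lemma Cmod_Cprod_unit f m : (forall i, (i < m)%nat -> Cmod (f i) = 1) -> Cmod (Cprod f m) = 1.
Proof.
induction m; simpl; intro H; [apply Cmod_C1|].
rewrite Cmod_Cmul, IHm, H; auto; ring.
Qed.

Lemma Cmod_theta k l : Cmod (theta n q k l) = 1.
Proof.
unfold theta. apply Cmod_Cprod_unit. intros i Hi. apply Cmod_Cprod_unit. intros j Hj.
apply Cmod_Cpowz_unit, hqabs; lia.
Qed.

Definition cterm (a b : coef) (m k : mindex) : CC :=
  if Nat.eqb (length k) n then
    Cmul (Cmul (a k) (b (vsub n m k))) (theta n q k (vsub n m k))
  else C0.

(** Here [|q_ij| = 1] enters: [theta] has modulus one, which leaves the submultiplicativity of the
    weight. *)
Lemma cterm_le a b m k : length m = n ->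
  Cmod (cterm a b m k) * w m <= (Cmod (a k) * w k) * (Cmod (b (vsub n m k)) * w (vsub n m k)).
Proof.
intro Hm. unfold cterm. destruct (Nat.eqb (length k) n).
- rewrite !Cmod_Cmul, Cmod_theta.
  pose proof (weight_vadd n rho tau k (vsub n m k) Hrad) as T. rewrite vadd_vsub in T by auto.
  pose proof (Cmod_nonneg (a k)); pose proof (Cmod_nonneg (b (vsub n m k))).
  assert (0 <= Cmod (a k) * Cmod (b (vsub n m k))) by (now apply Rmult_le_pos).
  apply Rmult_le_compat_l with (r := Cmod (a k) * Cmod (b (vsub n m k))) in T; lra.
- rewrite Cmod_C0, Rmult_0_l. apply Rmult_le_pos; apply nterm_nonneg.
Qed.

(** For fixed [m] the pairs [(k, m - k)] are distinct, so the terms are dominated by part of the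
    summable double family of [a] and [b]. *)
Lemma cterm_ub a b A B m : length m = n -> nl a A -> nl b B ->
  ub (fun k => Cmod (cterm a b m k)) (/ w m * (A * B)).
Proof.
intros Hm Ha Hb.
pose proof (ub_prod _ _ _ _ (nterm_nonneg a) (nterm_nonneg b) Ha Hb) as T.
apply ub_le with (g := fun k => / w m *
  ((Cmod (a k) * w k) * (Cmod (b (vsub n m k)) * w (vsub n m k)))).
- intro k. apply (Rmult_le_reg_r (w m)); [apply wpos|].
  pose proof (cterm_le a b m k Hm) as L. pose proof (wpos m).
  eapply Rle_trans; [exact L|]. right; field. lra.
- apply ub_scal; [apply Rlt_le, Rinv_0_lt_compat, wpos|].
  intros G HG.
  assert (HN : NoDup (map (fun k => (k, vsub n m k)) G)).
  { apply FinFun.Injective_map_NoDup; auto. intros k k' E. congruence. }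
  pose proof (T _ HN) as T'. rewrite lsumR_map in T'. exact T'.
Qed.

Lemma cmul_has_sum a b A B m : length m = n -> nl a A -> nl b B ->
  has_sumC (cterm a b m) (cmul n q a b m).
Proof.
intros Hm Ha Hb. unfold cmul. rewrite Hm, Nat.eqb_refl.
exact (Csum_spec (cterm a b m) _ (cterm_ub a b A B m Hm Ha Hb)).
Qed.

Lemma cmul_length a b m : length m <> n -> cmul n q a b m = C0.
Proof. intro H. unfold cmul. apply Nat.eqb_neq in H. now rewrite H. Qed.

Lemma cmul_unique a b m s : length m = n -> has_sumC (cterm a b m) s -> cmul n q a b m = s.
Proof. intros Hm H. unfold cmul. rewrite Hm, Nat.eqb_refl. now apply Csum_eq. Qed.

(** The double family over pairs [(k, l)] is regrouped along the fibres of [k + l]; [ub_fiber] does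
    this without rearranging infinite sums. *)
Lemma nle_mul a b A B : nl a A -> nl b B -> nl (cmul n q a b) (A * B).
Proof.
intros Ha Hb.
pose proof (ub_prod _ _ _ _ (nterm_nonneg a) (nterm_nonneg b) Ha Hb) as T.
refine (ub_fiber _ (fun p => vadd n (fst p) (snd p)) _ _ T _).
intros m eps He. destruct (Nat.eq_dec (length m) n) as [Hm|Hm].
- pose proof (cmul_has_sum a b A B m Hm Ha Hb) as HS. pose proof (wpos m) as Hw.
  destruct (has_sumC_finite_approx _ _ HS (eps / w m)) as [F [HF HF2]].
  { now apply Rdiv_lt_0_compat. }
  exists (map (fun k => (k, vsub n m k)) F). split; [|split].
  + apply FinFun.Injective_map_NoDup; auto. intros k k' E. congruence.
  + intros p Hp. apply in_map_iff in Hp. destruct Hp as [k [<- _]]. simpl. now apply vadd_vsub.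
  + rewrite lsumR_map. simpl.
    apply Rmult_le_compat_r with (r := w m) in HF2; [|lra].
    eapply Rle_trans; [exact HF2|].
    rewrite Rmult_plus_distr_r. replace (eps / w m * w m) with eps by (field; lra).
    apply Rplus_le_compat_r. rewrite Rmult_comm, <- lsumR_scal. apply lsumR_le.
    intros k _. rewrite Rmult_comm. now apply cterm_le.
- exists []. split; [constructor|]. split; [easy|]. rewrite cmul_length by auto.
  rewrite Cmod_C0. simpl. lra.
Qed.

Lemma cmul_addl a b c A B M : nl a A -> nl b B -> nl c M ->
  cmul n q (cadd a b) c = cadd (cmul n q a c) (cmul n q b c).
Proof.
intros Ha Hb Hc. extensionality m. unfold cadd at 2.
destruct (Nat.eq_dec (length m) n) as [Hm|Hm].
- apply cmul_unique; auto.
  replace (cterm (cadd a b) c m) with (fun k => Cadd (cterm a c m k) (cterm b c m k)).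
  + eapply has_sumC_add; eapply cmul_has_sum; eauto.
  + extensionality k. unfold cterm, cadd. destruct (Nat.eqb (length k) n); ring.
- rewrite !cmul_length by auto. ring.
Qed.

Lemma cmul_addr a b c A B M : nl a A -> nl b B -> nl c M ->
  cmul n q c (cadd a b) = cadd (cmul n q c a) (cmul n q c b).
Proof.
intros Ha Hb Hc. extensionality m. unfold cadd at 2.
destruct (Nat.eq_dec (length m) n) as [Hm|Hm].
- apply cmul_unique; auto.
  replace (cterm c (cadd a b) m) with (fun k => Cadd (cterm c a m k) (cterm c b m k)).
  + eapply has_sumC_add; eapply cmul_has_sum; eauto.
  + extensionality k. unfold cterm, cadd. destruct (Nat.eqb (length k) n); ring.
- rewrite !cmul_length by auto. ring.
Qed.

Lemma cmul_scalel s a c A M : nl a A -> nl c M ->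
  cmul n q (cscale s a) c = cscale s (cmul n q a c).
Proof.
intros Ha Hc. extensionality m. unfold cscale at 2.
destruct (Nat.eq_dec (length m) n) as [Hm|Hm].
- apply cmul_unique; auto.
  replace (cterm (cscale s a) c m) with (fun k => Cmul s (cterm a c m k)).
  + eapply has_sumC_scale; eapply cmul_has_sum; eauto.
  + extensionality k. unfold cterm, cscale. destruct (Nat.eqb (length k) n); ring.
- rewrite !cmul_length by auto. ring.
Qed.

Lemma cmul_scaler s a c A M : nl a A -> nl c M ->
  cmul n q c (cscale s a) = cscale s (cmul n q c a).
Proof.
intros Ha Hc. extensionality m. unfold cscale at 2.
destruct (Nat.eq_dec (length m) n) as [Hm|Hm].
- apply cmul_unique; auto.
  replace (cterm c (cscale s a) m) with (fun k => Cmul s (cterm c a m k)).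
  + eapply has_sumC_scale; eapply cmul_has_sum; eauto.
  + extensionality k. unfold cterm, cscale. destruct (Nat.eqb (length k) n); ring.
- rewrite !cmul_length by auto. ring.
Qed.

End Product.
End Norm.

Lemma cmul_mono n q k l : length k = n -> length l = n ->
  cmul n q (mono k) (mono l) = cscale (theta n q k l) (mono (vadd n k l)).
Proof.
intros Hk Hl. extensionality m. unfold cscale.
destruct (Nat.eq_dec (length m) n) as [Hm|Hm].
- apply cmul_unique; auto.
  replace (Cmul (theta n q k l) (mono (vadd n k l) m)) with (cterm n q (mono k) (mono l) m k).
  + apply has_sumC_single. intros x Hx. unfold cterm, mono.
    destruct (list_eq_dec Z.eq_dec x k); [congruence|].
    destruct (Nat.eqb (length x) n); ring.
  + unfold cterm, mono. rewrite Hk, Nat.eqb_refl.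
    destruct (list_eq_dec Z.eq_dec k k); [|congruence].
    destruct (list_eq_dec Z.eq_dec m (vadd n k l)) as [->|Hn].
    * rewrite vsub_vadd by auto. destruct (list_eq_dec Z.eq_dec l l); [ring | congruence].
    * destruct (list_eq_dec Z.eq_dec (vsub n m k) l) as [<-|]; [|ring].
      elim Hn. now rewrite vadd_vsub.
- rewrite cmul_length by auto. unfold mono.
  destruct (list_eq_dec Z.eq_dec m (vadd n k l)) as [->|]; [|ring].
  elim Hm. apply length_vadd.
Qed.

Lemma Cprod_1 f m : (forall i, (i < m)%nat -> f i = C1) -> Cprod f m = C1.
Proof.
induction m; simpl; intro H; [reflexivity|]. rewrite IHm, H; auto. ring.
Qed.

(* The hypothesis says that [x^k x^l] is already in normal order. *)
Lemma theta_1 n q k l :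
  (forall i j, (j < i < n)%nat -> (kcoord k i * kcoord l j)%Z = 0%Z) -> theta n q k l = C1.
Proof.
intro H. apply Cprod_1. intros i Hi. apply Cprod_1. intros j Hj. now rewrite H.
Qed.

(** * Lacunary exponents *)

(** Course-of-values recursion combined with choice. The earlier values are carried as a list, and
    the first hypothesis says that [Psi] looks only at them. *)
Lemma prefix_choice (Psi : nat -> (nat -> nat) -> nat -> Prop) :
  (forall l f g v, (forall j, (j < l)%nat -> f j = g j) -> Psi l f v -> Psi l g v) ->
  (forall l f, exists v, Psi l f v) -> exists f, forall l, Psi l f (f l).
Proof.
intros Hext Hex.
destruct (choice (fun L v => Psi (length L) (fun j => nth j L 0%nat) v)) as [F HF].
{ intro L. apply Hex. }
set (Ls := fix Ls l := match l with O => [] | S l' => Ls l' ++ [F (Ls l')] end).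
assert (HL : forall l, length (Ls l) = l).
{ induction l; simpl; auto. rewrite length_app, IHl; simpl; lia. }
assert (Hn : forall l j, (j < l)%nat -> nth j (Ls l) 0%nat = F (Ls j)).
{ induction l; intros j Hj; [lia|]. simpl. destruct (Nat.eq_dec j l) as [->|].
  - rewrite app_nth2; rewrite HL; auto. now rewrite Nat.sub_diag.
  - rewrite app_nth1 by (rewrite HL; lia). apply IHl; lia. }
exists (fun l => F (Ls l)). intro l.
pose proof (HF (Ls l)) as T. rewrite HL in T. eapply Hext; [|exact T]. apply Hn.
Qed.

Lemma pow_large x B : 1 < x -> exists M, forall m, (M <= m)%nat -> B <= x ^ m.
Proof.
intro Hx. destruct (Pow_x_infinity x) with (b := B) as [M HM].
{ rewrite Rabs_right; lra. }
exists M. intros m Hm. specialize (HM m Hm). rewrite Rabs_right in HM.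
- lra.
- apply Rle_ge, pow_le; lra.
Qed.

Lemma pow_small x e : 0 < x < 1 -> 0 < e -> exists M, forall m, (M <= m)%nat -> x ^ m <= e.
Proof.
intros Hx He. destruct (pow_lt_1_zero x) with (y := e) as [M HM]; auto.
{ rewrite Rabs_right; lra. }
exists M. intros m Hm. specialize (HM m Hm). apply Rabs_def2 in HM. lra.
Qed.

Lemma increasing_le (s : nat -> R) m p : (forall p, s p < s (S p)) -> (m <= p)%nat -> s m <= s p.
Proof.
intros H Hm. induction Hm as [|p Hm IH]; [lra|]. specialize (H p). lra.
Qed.

Lemma increasing_lt (s : nat -> R) m p : (forall p, s p < s (S p)) -> (m < p)%nat -> s m < s p.
Proof.
intros H Hm. apply (increasing_le s (S m) p) in Hm; auto. specialize (H m). lra.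
Qed.

Lemma div_gt1 x y : 0 < x < y -> 1 < y / x.
Proof.
intro H. apply (Rmult_lt_reg_r x); [lra|]. replace (y / x * x) with y by (field; lra). lra.
Qed.

Lemma div_lt1 x y : 0 < x < y -> 0 < x / y < 1.
Proof.
intro H. split; [apply Rdiv_lt_0_compat; lra|].
apply (Rmult_lt_reg_r y); [lra|]. replace (x / y * y) with x by (field; lra). lra.
Qed.

(** The size of the term [(y/c_l)^(n_l)] at radius [x], with [c_l = s (3 l)]. *)
Definition lac (s : nat -> R) (ns : nat -> nat) (l : nat) (x : R) : R := (x / s (3 * l)%nat) ^ ns l.

(* The term of index [l] is negligible up to the radius [s (3 l - 1)] and dominates
   the earlier ones from the radius [s (3 l + 1)] on. *)
Lemma lacunary (s t : nat -> R) : (forall p, 0 < s p) -> (forall p, s p < s (S p)) ->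
  exists ns : nat -> nat, forall l,
    lac s ns l (s (3 * l - 1)%nat) <= (/2) ^ l /\
    lsumR (fun j => lac s ns j (s (3 * l + 1)%nat)) (seq 0 l) + 1 + t l
      <= lac s ns l (s (3 * l + 1)%nat) /\
    2 * (lsumR (fun j => lac s ns j (s (3 * l + 4)%nat)) (seq 0 (S l)) +
         lsumR (fun j => lac s ns j (s (3 * l + 5)%nat)) (seq 0 l) + 4)
      <= lac s ns l (s (3 * l + 5)%nat).
Proof.
intros Hp Hs.
set (low := fun l (f : nat -> nat) x => lsumR (fun j => lac s f j x) (seq 0 l)).
destruct (prefix_choice (fun l f v =>
    (s (3 * l - 1)%nat / s (3 * l)%nat) ^ v <= (/2) ^ l /\
    low l f (s (3 * l + 1)%nat) + 1 + t l <= (s (3 * l + 1)%nat / s (3 * l)%nat) ^ v /\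
    2 * (low l f (s (3 * l + 4)%nat) + (s (3 * l + 4)%nat / s (3 * l)%nat) ^ v
         + low l f (s (3 * l + 5)%nat) + 4) <= (s (3 * l + 5)%nat / s (3 * l)%nat) ^ v))
  as [ns Hns].
- intros l f g v Hfg.
  assert (E : forall x, low l f x = low l g x).
  { intro x. apply lsumR_ext. intros j Hj. apply in_seq in Hj. unfold lac. rewrite Hfg by lia. auto. }
  now rewrite !E.
- intros l f.
  assert (H1 : exists M, forall m, (M <= m)%nat ->
    (s (3 * l - 1)%nat / s (3 * l)%nat) ^ m <= (/2) ^ l).
  (* For [l = 0] truncated subtraction makes [3 l - 1] equal to [3 l]; the ratio is then 1, and so
     is [(/2) ^ 0]. *)
  { destruct l as [|l].
    - exists 0%nat. intros m _. simpl. replace (s 0%nat / s 0%nat) with 1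
        by (field; specialize (Hp 0%nat); lra). rewrite pow1. lra.
    - apply pow_small; [|apply pow_lt; lra]. apply div_lt1. split; auto.
      apply increasing_lt; auto; lia. }
  destruct H1 as [M1 H1].
  destruct (pow_large (s (3 * l + 1)%nat / s (3 * l)%nat) (low l f (s (3 * l + 1)%nat) + 1 + t l))
    as [M2 H2]. { apply div_gt1; split; auto. apply increasing_lt; auto; lia. }
  destruct (pow_large (s (3 * l + 4)%nat / s (3 * l)%nat)
     (2 * (low l f (s (3 * l + 4)%nat) + low l f (s (3 * l + 5)%nat) + 4)))
    as [M3 H3]. { apply div_gt1; split; auto. apply increasing_lt; auto; lia. }
  (* The factor 3 is used as 2 + 1: twice the term itself at [s (3 l + 4)], and one more copy that
     absorbs the bound of [H3]. *)
  destruct (pow_large (s (3 * l + 5)%nat / s (3 * l + 4)%nat) 3)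
    as [M4 H4]. { apply div_gt1; split; auto. apply increasing_lt; auto; lia. }
  exists (M1 + M2 + M3 + M4)%nat. set (v := (M1 + M2 + M3 + M4)%nat).
  split; [apply H1; lia|]. split; [apply H2; lia|].
  specialize (H3 v ltac:(lia)). specialize (H4 v ltac:(lia)).
  replace (s (3 * l + 5)%nat / s (3 * l)%nat) with
    ((s (3 * l + 5)%nat / s (3 * l + 4)%nat) * (s (3 * l + 4)%nat / s (3 * l)%nat)).
  2:{ pose proof (Hp (3 * l)%nat); pose proof (Hp (3 * l + 4)%nat). field. lra. }
  rewrite Rpow_mult_distr.
  set (u := (s (3 * l + 4)%nat / s (3 * l)%nat) ^ v) in *.
  assert (0 < u). { apply pow_lt, Rdiv_lt_0_compat; auto. }
  assert (3 * u <= (s (3 * l + 5)%nat / s (3 * l + 4)%nat) ^ v * u)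
    by (apply Rmult_le_compat_r; lra). lra.
- exists ns. intro l. destruct (Hns l) as [H1 [H2 H3]]. split; [exact H1|]. split; [exact H2|].
  rewrite seq_S, lsumR_app.
  fold (low l ns (s (3 * l + 4)%nat)). fold (low l ns (s (3 * l + 5)%nat)).
  change (lsumR (fun j => lac s ns j (s (3 * l + 4)%nat)) [(0 + l)%nat])
    with ((s (3 * l + 4)%nat / s (3 * l)%nat) ^ ns l + 0).
  change (lac s ns l (s (3 * l + 5)%nat)) with ((s (3 * l + 5)%nat / s (3 * l)%nat) ^ ns l).
  lra.
Qed.

Lemma geom_half a k : lsumR (fun l => (/2) ^ l) (seq a k) <= 2 * (/2) ^ a.
Proof.
revert a. induction k as [|k IH]; intro a; simpl.
- assert (0 < (/2) ^ a) by (apply pow_lt; lra). lra.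
- specialize (IH (S a)). simpl in IH. lra.
Qed.

(** * The Fréchet algebra structure *)

Lemma admissible_radii n r Rr rho tau :
  (forall i, (i < n)%nat -> 0 <= r i) -> admissible n r Rr rho tau -> radii n rho tau.
Proof. intros H0 H i Hi. destruct (H i Hi) as [? []]. specialize (H0 i Hi). lra. Qed.

Lemma nle_radii_le n rho tau rho' tau' a M : radii n rho tau ->
  (forall i, (i < n)%nat -> 0 < rho' i /\ rho' i <= rho i /\ tau i <= tau' i) ->
  nle n rho' tau' a M -> nle n rho tau a M.
Proof.
intros H H'. apply ub_le. intro k. apply Rmult_le_compat_l; [apply Cmod_nonneg|].
now apply weight_le.
Qed.

(** * An exhausting sequence of radii *)

Section Exhaustion.
Context (r : nat -> R) (Rr : nat -> option R).

(** A base radius inside the interval: inner radii stay below it and outer radii above it, so the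
    two sequences never cross. *)
Definition midr (i : nat) : R :=
  match Rr i with None => r i + 1 | Some y => (r i + y) / 2 end.
(** The offset 2 keeps the fraction strictly below one already at [m = 0]. *)
Definition rseq (m i : nat) : R := r i + (midr i - r i) / (INR m + 2).
Definition tseq (m i : nat) : R :=
  match Rr i with None => midr i + (INR m + 1) | Some y => y - (y - midr i) / (INR m + 2) end.

Lemma midr_gt i : ltext (r i) (Rr i) -> r i < midr i.
Proof. unfold ltext, below, midr. destruct (Rr i); lra. Qed.

Lemma frac_anti c m p : 0 <= c -> (m <= p)%nat -> c / (INR p + 2) <= c / (INR m + 2).
Proof.
intros Hc H. apply le_INR in H. pose proof (pos_INR m).
apply Rmult_le_compat_l; auto. apply Rinv_le_contravar; lra.
Qed.

Lemma frac_lt c m : 0 < c -> c / (INR (S m) + 2) < c / (INR m + 2).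
Proof.
intro Hc. rewrite S_INR. pose proof (pos_INR m).
apply Rmult_lt_compat_l; auto. apply Rinv_lt_contravar; [|lra].
apply Rmult_lt_0_compat; lra.
Qed.

Lemma frac_bounds c m : 0 < c -> 0 < c / (INR m + 2) < c.
Proof.
intro Hc. pose proof (pos_INR m). split; [apply Rdiv_lt_0_compat; lra|].
apply (Rmult_lt_reg_r (INR m + 2)); [lra|].
replace (c / (INR m + 2) * (INR m + 2)) with c by (field; lra). nra.
Qed.

Lemma frac_small c e : 0 < e -> exists M, forall m, (M <= m)%nat -> c / (INR m + 2) <= e.
Proof.
intro He. destruct (INR_unbounded (c / e)) as [M HM]. exists M. intros m Hm.
apply le_INR in Hm. pose proof (pos_INR m).
apply (Rmult_le_reg_r (INR m + 2)); [lra|].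
replace (c / (INR m + 2) * (INR m + 2)) with c by (field; lra).
replace c with (e * (c / e)) at 1 by (field; lra).
apply Rmult_le_compat_l; lra.
Qed.

Lemma rseq_anti i m p : ltext (r i) (Rr i) -> (m <= p)%nat -> rseq p i <= rseq m i.
Proof.
intros H Hm. apply midr_gt in H. unfold rseq.
pose proof (frac_anti (midr i - r i) m p ltac:(lra) Hm). lra.
Qed.

Lemma rseq_lt i m : ltext (r i) (Rr i) -> rseq (S m) i < rseq m i.
Proof.
intros H. apply midr_gt in H. unfold rseq.
pose proof (frac_lt (midr i - r i) m ltac:(lra)). lra.
Qed.

Lemma rseq_bounds i m : ltext (r i) (Rr i) -> r i < rseq m i < midr i.
Proof.
intros H. apply midr_gt in H. unfold rseq.
pose proof (frac_bounds (midr i - r i) m ltac:(lra)). lra.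
Qed.

Lemma tseq_mono i m p : ltext (r i) (Rr i) -> (m <= p)%nat -> tseq m i <= tseq p i.
Proof.
intros H Hm. pose proof (le_INR _ _ Hm). pose proof (midr_gt i H).
unfold tseq, midr, ltext, below in *. destruct (Rr i) as [y|]; [|lra].
pose proof (frac_anti (y - (r i + y) / 2) m p ltac:(lra) Hm). lra.
Qed.

Lemma tseq_lt i m : ltext (r i) (Rr i) -> tseq m i < tseq (S m) i.
Proof.
intros H. pose proof (midr_gt i H). pose proof (S_INR m).
unfold tseq, midr, ltext, below in *. destruct (Rr i) as [y|]; [|lra].
pose proof (frac_lt (y - (r i + y) / 2) m ltac:(lra)). lra.
Qed.

Lemma tseq_bounds i m : ltext (r i) (Rr i) -> midr i < tseq m i /\ below (Rr i) (tseq m i).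
Proof.
intros H. pose proof (midr_gt i H). pose proof (pos_INR m).
unfold tseq, midr, ltext, below in *. destruct (Rr i) as [y|]; [|lra].
pose proof (frac_bounds (y - (r i + y) / 2) m ltac:(lra)). lra.
Qed.

Lemma seq_cofinal1 i rho tau : r i < rho -> below (Rr i) tau ->
  exists M, forall m, (M <= m)%nat -> rseq m i <= rho /\ tau <= tseq m i.
Proof.
intros H H'. destruct (frac_small (midr i - r i) (rho - r i) ltac:(lra)) as [M HM].
assert (exists M', forall m, (M' <= m)%nat -> tau <= tseq m i) as [M' HM'].
{ unfold tseq, below in *. destruct (Rr i) as [y|].
  - destruct (frac_small (y - midr i) (y - tau) ltac:(lra)) as [M' HM'].
    exists M'. intros m Hm. specialize (HM' m Hm). lra.
  - destruct (INR_unbounded (tau - midr i)) as [M' HM']. exists M'. intros m Hm.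
    apply le_INR in Hm. lra. }
exists (M + M')%nat. intros m Hm. specialize (HM m ltac:(lia)). specialize (HM' m ltac:(lia)).
unfold rseq. lra.
Qed.

Lemma admissible_seq n m : (forall i, (i < n)%nat -> ltext (r i) (Rr i)) ->
  admissible n r Rr (rseq m) (tseq m).
Proof.
intros H i Hi. pose proof (rseq_bounds i m (H i Hi)). pose proof (tseq_bounds i m (H i Hi)).
intuition lra.
Qed.

Lemma seq_cofinal n rho tau : admissible n r Rr rho tau ->
  exists M, forall m, (M <= m)%nat -> forall i, (i < n)%nat -> rseq m i <= rho i /\ tau i <= tseq m i.
Proof.
intro H. induction n as [|n IH].
- exists 0%nat. lia.
- destruct IH as [M HM]. { intros i Hi. apply H; lia. }
  destruct (H n ltac:(lia)) as [H1 [_ H2]].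
  destruct (seq_cofinal1 n (rho n) (tau n) H1 H2) as [M' HM'].
  exists (M + M')%nat. intros m Hm i Hi. destruct (Nat.eq_dec i n) as [->|].
  + apply HM'; lia.
  + apply HM; lia.
Qed.

End Exhaustion.

Section Algebra.
Context (n : nat) (q : nat -> nat -> CC) (r : nat -> R) (Rr : nat -> option R).
Hypothesis hqabs : forall i j, (i < n)%nat -> (j < n)%nat -> Cmod (q i j) = 1.
Hypothesis hr0 : forall i, (i < n)%nat -> 0 <= r i.
Hypothesis hrR : forall i, (i < n)%nat -> ltext (r i) (Rr i).

Notation rs := (rseq r Rr).
Notation ts := (tseq r Rr).
Notation A := (InA n r Rr).
Notation adm := (admissible n r Rr).
Definition lev (m : nat) (a : coef) (M : R) : Prop := nle n (rs m) (ts m) a M.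
Definition lw (m : nat) (k : mindex) : R := weight n (rs m) (ts m) k.

Lemma adm_seq m : adm (rs m) (ts m).
Proof. now apply admissible_seq. Qed.

Lemma adm_rad rho tau : adm rho tau -> radii n rho tau.
Proof. now apply admissible_radii. Qed.

Lemma radm m : radii n (rs m) (ts m).
Proof. apply adm_rad, adm_seq. Qed.

Lemma lw_pos m k : 0 < lw m k.
Proof. apply weight_pos, radm. Qed.

Lemma lev_anti m p a M : (m <= p)%nat -> lev p a M -> lev m a M.
Proof.
intro H. apply nle_radii_le; [apply radm|]. intros i Hi.
split; [|split]; [apply (radm p i Hi) | apply rseq_anti | apply tseq_mono]; auto.
Qed.

(** Every defining norm is dominated by all sufficiently high levels, so membership and convergence
    can be tested on the sequence of levels. *)
Lemma adm_lev rho tau : adm rho tau -> exists m0, forall m, (m0 <= m)%nat ->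
  forall a M, lev m a M -> nle n rho tau a M.
Proof.
intro H. destruct (seq_cofinal r Rr n rho tau H) as [m0 Hm0]. exists m0. intros m Hm a M.
apply nle_radii_le; [now apply adm_rad|]. intros i Hi. split; [apply (radm m i Hi) | now apply Hm0].
Qed.

Lemma InA_nle a rho tau : A a -> adm rho tau -> exists M, nle n rho tau a M.
Proof. intros [_ H] H'. exact (H rho tau H'). Qed.

Lemma InA_lev a m : A a -> exists M, lev m a M.
Proof. intros H. apply InA_nle; auto using adm_seq. Qed.

Lemma lev_InA a : (forall k, length k <> n -> a k = C0) -> (forall m, exists M, lev m a M) -> A a.
Proof.
intros H0 H. split; auto. intros rho tau Had. destruct (adm_lev rho tau Had) as [m Hm].
destruct (H m) as [M HM]. exists M. exact (Hm m (Nat.le_refl _) a M HM).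
Qed.

Lemma InA_mono k : length k = n -> A (mono k).
Proof.
intro Hk. apply lev_InA.
- intros m Hm. unfold mono. destruct (list_eq_dec Z.eq_dec m k); congruence.
- intro m. exists (lw m k). apply nle_mono, radm.
Qed.

Lemma cunit_mono : cunit n = mono (zero_index n).
Proof. reflexivity. Qed.

Lemma InA_cunit : A (cunit n).
Proof. rewrite cunit_mono. apply InA_mono, length_zero. Qed.

Lemma InA_czero : A czero.
Proof. apply lev_InA; auto. intro m. exists 0. apply nle_zero. lra. Qed.

Lemma InA_cadd a b : A a -> A b -> A (cadd a b).
Proof.
intros Ha Hb. apply lev_InA.
- intros k Hk. unfold cadd. rewrite (proj1 Ha k Hk), (proj1 Hb k Hk). ring.
- intro m. destruct (InA_lev a m Ha) as [M HM], (InA_lev b m Hb) as [M' HM'].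
  exists (M + M'). apply nle_add; auto using radm.
Qed.

Lemma InA_cscale c a : A a -> A (cscale c a).
Proof.
intros Ha. apply lev_InA.
- intros k Hk. unfold cscale. rewrite (proj1 Ha k Hk). ring.
- intro m. destruct (InA_lev a m Ha) as [M HM]. exists (Cmod c * M). now apply nle_scale.
Qed.

Lemma InA_csub a b : A a -> A b -> A (csub a b).
Proof.
intros Ha Hb. apply lev_InA.
- intros k Hk. unfold csub. rewrite (proj1 Ha k Hk), (proj1 Hb k Hk). ring.
- intro m. destruct (InA_lev a m Ha) as [M HM], (InA_lev b m Hb) as [M' HM'].
  exists (M + M'). apply nle_sub; auto using radm.
Qed.

Lemma InA_cmul a b : A a -> A b -> A (cmul n q a b).
Proof.
intros Ha Hb. apply lev_InA.
- intros k Hk. now apply cmul_length.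
- intro m. destruct (InA_lev a m Ha) as [M HM], (InA_lev b m Hb) as [M' HM'].
  exists (M * M'). apply nle_mul; auto using radm.
Qed.

Lemma InA_lsumA {X : Type} (F : X -> coef) G : (forall x, In x G -> A (F x)) -> A (lsumA F G).
Proof.
induction G as [|x G IH]; intro H; [apply InA_czero|].
rewrite lsumA_cons. apply InA_cadd; [|apply IH; intros]; apply H; simpl; auto.
Qed.

Lemma InA_complete (x : nat -> coef) : (forall m, A (x m)) ->
  (forall rho tau, adm rho tau -> forall eps, 0 < eps -> exists M, forall m p,
     (M <= m)%nat -> (M <= p)%nat -> nle n rho tau (csub (x m) (x p)) eps) ->
  exists y, A y /\ forall rho tau, adm rho tau -> forall eps, 0 < eps ->
    exists M, forall m, (M <= m)%nat -> nle n rho tau (csub (x m) y) eps.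
Proof.
intros Hx HC.
destruct (l1_complete x (fun w => exists rho tau, adm rho tau /\ w = weight n rho tau))
  as [y Hy].
- intros w k [rho [tau [Had ->]]]. apply weight_pos. now apply adm_rad.
- exists (weight n (rs 0) (ts 0)), (rs 0), (ts 0). split; auto using adm_seq.
- intros w [rho [tau [Had ->]]]. now apply HC.
- assert (Hlim : forall rho tau, adm rho tau -> forall eps, 0 < eps ->
    exists M, forall m, (M <= m)%nat -> nle n rho tau (csub (x m) y) eps).
  { intros rho tau Had. apply Hy. eauto. }
  exists y. split; auto. apply lev_InA.
  (* A nonzero coefficient of [y] at a list of the wrong length would keep the distance to every
     [x m] bounded below. *)
  + intros k Hk. apply Cmod_eq0. apply Rle_antisym; [|apply Cmod_nonneg].
    apply Rnot_lt_le. intro Hp. pose proof (lw_pos 0 k) as Hw.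
    destruct (Hlim (rs 0) (ts 0) (adm_seq 0) (Cmod (y k) * lw 0 k / 2)) as [M HM].
    { apply Rdiv_lt_0_compat; [apply Rmult_lt_0_compat|]; lra. }
    pose proof (ub_term _ _ k (HM M (Nat.le_refl _))) as T. simpl in T. unfold csub in T.
    rewrite (proj1 (Hx M) k Hk), Cmod_sub_sym in T.
    replace (Csub (y k) C0) with (y k) in T by ring. fold (lw 0 k) in T.
    assert (0 < Cmod (y k) * lw 0 k) by (apply Rmult_lt_0_compat; lra). lra.
  + intro m. destruct (Hlim (rs m) (ts m) (adm_seq m) 1 ltac:(lra)) as [M HM].
    destruct (InA_lev (x M) m (Hx M)) as [B HB]. exists (B + 1).
    pose proof (nle_sub n (rs m) (ts m) (radm m) _ _ _ _ HB (HM M (Nat.le_refl _))) as T.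
    eapply ub_le; [|exact T]. intro k. unfold csub. simpl. right. f_equal. f_equal. ring.
Qed.

Lemma FrechetAM_holds : FrechetAM n q r Rr.
Proof.
split; [|split; [|split; [|split]]].
- exact InA_cunit.
- intros a b Ha Hb. split; [|split; [|split]].
  + now apply InA_cadd.
  + intro c. now apply InA_cscale.
  + now apply InA_cmul.
  + intros rho tau Had. pose proof (adm_rad _ _ Had) as Hr.
    destruct (InA_nle a _ _ Ha Had) as [M HM], (InA_nle b _ _ Hb Had) as [M' HM'].
    apply nle_cnorm; auto. apply nle_mul; auto; eapply nle_cnorm; eauto.
- intros a Ha H. extensionality k. apply Cmod_eq0. apply Rle_antisym; [|apply Cmod_nonneg].
  pose proof (adm_seq 0) as Had. destruct (InA_lev a 0 Ha) as [M HM].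
  destruct (nle_cnorm n _ _ (radm 0) a M HM) as [T _]. rewrite (H _ _ Had) in T.
  apply (ub_term _ _ k) in T. change (Cmod (a k) * lw 0 k <= 0) in T. pose proof (lw_pos 0 k).
  apply (Rmult_le_reg_r (lw 0 k)); lra.
- exists rs, ts. split; [exact adm_seq|]. intros rho tau Had.
  destruct (adm_lev rho tau Had) as [m Hm]. exists m, 1. intros a Ha. rewrite Rmult_1_l.
  apply nle_cnorm; [now apply adm_rad|]. apply (Hm m); auto.
  destruct (InA_lev a m Ha) as [M HM]. apply (nle_cnorm n _ _ (radm m) a M HM).
- intros x Hx HC. destruct (InA_complete x Hx) as [y [Hy1 Hy2]].
  + intros rho tau Had eps He. destruct (HC rho tau Had eps He) as [M HM]. exists M.
    intros m p Hm Hp. pose proof (InA_csub _ _ (Hx m) (Hx p)) as Hd.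
    destruct (InA_nle _ _ _ Hd Had) as [B HB].
    eapply nle_weaken; [eapply nle_cnorm; eauto using adm_rad|]. now apply Rlt_le, HM.
  + exists y. split; auto. intros rho tau Had eps He.
    destruct (Hy2 rho tau Had (eps / 2) ltac:(lra)) as [M HM]. exists M. intros m Hm.
    eapply Rle_lt_trans; [eapply nle_cnorm; eauto using adm_rad | lra].
Qed.

(** * Bilinearity of the product and finite sums in the algebra *)

Lemma lev_add m a b M M' : lev m a M -> lev m b M' -> lev m (cadd a b) (M + M').
Proof. apply nle_add, radm. Qed.

(** The product does not mention the radii, so summability at the single level 0, supplied by
    membership, is enough. *)
Lemma cmulA_addl a b c : A a -> A b -> A c ->
  cmul n q (cadd a b) c = cadd (cmul n q a c) (cmul n q b c).
Proof.
intros Ha Hb Hc. destruct (InA_lev a 0 Ha), (InA_lev b 0 Hb), (InA_lev c 0 Hc).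
eapply cmul_addl; eauto using radm.
Qed.

Lemma cmulA_addr a b c : A a -> A b -> A c ->
  cmul n q c (cadd a b) = cadd (cmul n q c a) (cmul n q c b).
Proof.
intros Ha Hb Hc. destruct (InA_lev a 0 Ha), (InA_lev b 0 Hb), (InA_lev c 0 Hc).
eapply cmul_addr; eauto using radm.
Qed.

Lemma cmulA_scalel s a c : A a -> A c -> cmul n q (cscale s a) c = cscale s (cmul n q a c).
Proof.
intros Ha Hc. destruct (InA_lev a 0 Ha), (InA_lev c 0 Hc). eapply cmul_scalel; eauto using radm.
Qed.

Lemma cmulA_scaler s a c : A a -> A c -> cmul n q c (cscale s a) = cscale s (cmul n q c a).
Proof.
intros Ha Hc. destruct (InA_lev a 0 Ha), (InA_lev c 0 Hc). eapply cmul_scaler; eauto using radm.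
Qed.

Lemma csub_scale a b : csub a b = cadd a (cscale (Cneg C1) b).
Proof. extensionality k. unfold csub, cadd, cscale. ring. Qed.

Lemma cmulA_subr a b c : A a -> A b -> A c ->
  cmul n q c (csub a b) = csub (cmul n q c a) (cmul n q c b).
Proof.
intros. rewrite !csub_scale, cmulA_addr, cmulA_scaler; auto using InA_cscale.
Qed.

Lemma cmulA_zeror c : A c -> cmul n q c czero = czero.
Proof.
intros. replace czero with (cscale C0 czero) at 1
  by (extensionality k; unfold cscale, czero; ring).
rewrite cmulA_scaler; auto using InA_czero. extensionality k; unfold cscale, czero; ring.
Qed.

Lemma cmulA_zerol c : A c -> cmul n q czero c = czero.
Proof.
intros. replace czero with (cscale C0 czero) at 1
  by (extensionality k; unfold cscale, czero; ring).
rewrite cmulA_scalel; auto using InA_czero. extensionality k; unfold cscale, czero; ring.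
Qed.

Lemma cmulA_lsuml {X : Type} (F : X -> coef) G c : (forall x, In x G -> A (F x)) -> A c ->
  cmul n q (lsumA F G) c = lsumA (fun x => cmul n q (F x) c) G.
Proof.
intros H Hc. induction G as [|x G IH]; [now apply cmulA_zerol|].
rewrite !lsumA_cons, cmulA_addl, IH; auto.
- intros; apply H; simpl; auto.
- apply H; simpl; auto.
- apply InA_lsumA. intros; apply H; simpl; auto.
Qed.

Lemma lsumA_app {X : Type} (F : X -> coef) G G' : lsumA F (G ++ G') = cadd (lsumA F G) (lsumA F G').
Proof.
induction G as [|x G IH]; simpl app.
- extensionality k; unfold cadd; simpl; ring.
- rewrite !lsumA_cons, IH. extensionality k; unfold cadd; ring.
Qed.

Lemma lsumA_ext {X : Type} (F F' : X -> coef) G : (forall x, In x G -> F x = F' x) ->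
  lsumA F G = lsumA F' G.
Proof.
induction G as [|x G IH]; intro H; [reflexivity|].
rewrite !lsumA_cons, H, IH; simpl; auto. intros; apply H; simpl; auto.
Qed.

Lemma lsumA_scale {X : Type} (F : X -> coef) c G :
  lsumA (fun x => cscale c (F x)) G = cscale c (lsumA F G).
Proof.
induction G as [|x G IH].
- extensionality k; unfold cscale; simpl; ring.
- rewrite !lsumA_cons, IH. extensionality k; unfold cscale, cadd; ring.
Qed.

Lemma lsumA_plus {X : Type} (F F' : X -> coef) G :
  lsumA (fun x => cadd (F x) (F' x)) G = cadd (lsumA F G) (lsumA F' G).
Proof.
induction G as [|x G IH].
- extensionality k; unfold cadd; simpl; ring.
- rewrite !lsumA_cons, IH. extensionality k; unfold cadd; ring.
Qed.

(** * Approximation by noncommutative polynomials in the generators *)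

Section Words.
Context (N : nat) (gens : nat -> coef).
Hypothesis hgens : forall a, (a < N)%nat -> A (gens a).

Notation we := (word_eval n q gens).

Definition okw (w : word) : Prop := forall a, In a w -> (a < N)%nat.

(** An unreduced list of terms, so that concatenation is addition. Repeated words make [cost] an
    upper bound for the norm of the collected polynomial ([coefP_ub]). *)
Definition npoly : Type := list (CC * word).

Definition ev (P : npoly) : coef := lsumA (fun cw => cscale (fst cw) (we (snd cw))) P.
Definition cost (t : R) (P : npoly) : R := lsumR (fun cw => Cmod (fst cw) * t ^ length (snd cw)) P.
Definition okP (P : npoly) : Prop := forall cw, In cw P -> okw (snd cw).

Lemma InA_word w : okw w -> A (we w).
Proof.
induction w as [|a w IH]; intro H; [apply InA_cunit|].
apply InA_cmul; [apply hgens, H; simpl; auto|]. apply IH. intros b Hb. apply H; simpl; auto.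
Qed.

Lemma InA_ev P : okP P -> A (ev P).
Proof. intro H. apply InA_lsumA. intros cw Hcw. apply InA_cscale, InA_word; auto. Qed.

Lemma okP_app P Q : okP P -> okP Q -> okP (P ++ Q).
Proof. intros HP HQ cw H. apply in_app_iff in H. destruct H; auto. Qed.

Lemma ev_app P Q : ev (P ++ Q) = cadd (ev P) (ev Q).
Proof. apply lsumA_app. Qed.

Lemma cost_app t P Q : cost t (P ++ Q) = cost t P + cost t Q.
Proof. apply lsumR_app. Qed.

Lemma cost_mono t t' P : 0 <= t <= t' -> cost t P <= cost t' P.
Proof.
intro Ht. apply lsumR_le. intros. apply Rmult_le_compat_l; [apply Cmod_nonneg | now apply pow_incr].
Qed.

Definition lmulP (a : nat) (P : npoly) : npoly := map (fun cw => (fst cw, a :: snd cw)) P.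
Definition scaleP (c : CC) (P : npoly) : npoly := map (fun cw => (Cmul c (fst cw), snd cw)) P.

(** [word_eval] nests to the right, so a generator on the left is one letter prepended to every
    word. *)
Lemma ev_lmul a P : (a < N)%nat -> okP P -> ev (lmulP a P) = cmul n q (gens a) (ev P).
Proof.
intros Ha. induction P as [|[c w] P IH]; intro HP; [symmetry; now apply cmulA_zeror, hgens|].
assert (HP' : okP P) by (intros x Hx; apply HP; simpl; auto).
assert (Hw : okw w) by (apply (HP (c, w)); simpl; auto).
change (cadd (cscale c (cmul n q (gens a) (we w))) (ev (lmulP a P)) =
        cmul n q (gens a) (cadd (cscale c (we w)) (ev P))).
rewrite IH, cmulA_addr, cmulA_scaler; auto using InA_word, InA_cscale, InA_ev.
Qed.

Lemma cost_lmul t a P : cost t (lmulP a P) = t * cost t P.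
Proof.
unfold cost, lmulP. rewrite lsumR_map, <- lsumR_scal. apply lsumR_ext. intros; simpl; ring.
Qed.

Lemma ev_scale c P : ev (scaleP c P) = cscale c (ev P).
Proof.
unfold ev. rewrite <- lsumA_scale. induction P as [|x P IH]; [reflexivity|].
simpl scaleP. rewrite !lsumA_cons, IH. simpl. f_equal.
extensionality k; unfold cscale; ring.
Qed.

Lemma cost_scale t c P : cost t (scaleP c P) = Cmod c * cost t P.
Proof.
unfold cost, scaleP. rewrite lsumR_map, <- lsumR_scal. apply lsumR_ext.
intros; cbn [fst snd]. rewrite Cmod_Cmul. apply Rmult_assoc.
Qed.

(* The cost [M] must not depend on the error [e]: this is what lets the
   successive corrections in [telescope] converge to an entire series. *)
Definition Appr (t : R) (p : nat) (f : coef) (M e : R) : Prop :=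
  exists P, okP P /\ cost t P <= M /\ lev p (csub f (ev P)) e.

Lemma Appr_zero t p f e : lev p f e -> Appr t p f 0 e.
Proof.
intro H. exists []. split; [easy|]. split; [unfold cost; simpl; lra|].
replace (csub f (ev [])) with f; auto.
extensionality k. change (f k = Csub (f k) C0). ring.
Qed.

Lemma Appr_weaken t p f M e M' e' : Appr t p f M e -> M <= M' -> e <= e' -> Appr t p f M' e'.
Proof.
intros [P [H1 [H2 H3]]] HM He. exists P. split; auto. split; [lra|]. eapply nle_weaken; eauto.
Qed.

Lemma Appr_add t p f g M M' e e' : Appr t p f M e -> Appr t p g M' e' ->
  Appr t p (cadd f g) (M + M') (e + e').
Proof.
intros [P [H1 [H2 H3]]] [Q [H4 [H5 H6]]]. exists (P ++ Q).
split; [now apply okP_app|]. split; [rewrite cost_app; lra|]. rewrite ev_app.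
replace (csub (cadd f g) (cadd (ev P) (ev Q))) with (cadd (csub f (ev P)) (csub g (ev Q)))
  by (extensionality k; unfold csub, cadd; ring).
now apply lev_add.
Qed.

Lemma Appr_scale t p f M e c : Appr t p f M e -> Appr t p (cscale c f) (Cmod c * M) (Cmod c * e).
Proof.
intros [P [H1 [H2 H3]]]. exists (scaleP c P). split; [|split].
- intros x Hx. apply in_map_iff in Hx. destruct Hx as [y [<- Hy]]. exact (H1 y Hy).
- rewrite cost_scale. apply Rmult_le_compat_l; auto using Cmod_nonneg.
- rewrite ev_scale. replace (csub (cscale c f) (cscale c (ev P))) with (cscale c (csub f (ev P)))
    by (extensionality k; unfold csub, cscale; ring).
  now apply nle_scale.
Qed.

Lemma Appr_sub t p f g M M' e e' : Appr t p f M e -> Appr t p g M' e' ->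
  Appr t p (csub f g) (M + M') (e + e').
Proof.
intros H H'. apply (Appr_scale _ _ _ _ _ (Cneg C1)) in H'.
rewrite Cmod_neg, Cmod_C1, !Rmult_1_l in H'. rewrite csub_scale. now apply Appr_add.
Qed.

Lemma Appr_sum {X : Type} t p (F : X -> coef) (M e : X -> R) G :
  (forall x, In x G -> Appr t p (F x) (M x) (e x)) -> Appr t p (lsumA F G) (lsumR M G) (lsumR e G).
Proof.
induction G as [|x G IH]; intro H; [apply Appr_zero, nle_zero; simpl; lra|].
rewrite lsumA_cons. simpl. apply Appr_add; [|apply IH; intros]; apply H; simpl; auto.
Qed.

(** A letter multiplies the cost by [t] whatever the size of the generator, and the error by a norm
    bound for the generator. This asymmetry is what makes large generators useful. *)
Lemma Appr_lmul t p f M e a G : 0 <= t -> (a < N)%nat -> A f -> lev p (gens a) G ->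
  Appr t p f M e -> Appr t p (cmul n q (gens a) f) (t * M) (G * e).
Proof.
intros Ht Ha Hf HG [P [H1 [H2 H3]]]. exists (lmulP a P). split; [|split].
- intros x Hx. apply in_map_iff in Hx. destruct Hx as [y [<- Hy]].
  intros b [<-|Hb]; auto. exact (H1 y Hy b Hb).
- rewrite cost_lmul. now apply Rmult_le_compat_l.
- rewrite ev_lmul, <- cmulA_subr; auto using InA_ev.
  apply nle_mul; auto using radm.
Qed.

Lemma Appr_close t p f g M e e' : Appr t p f M e -> lev p (csub g f) e' -> Appr t p g M (e' + e).
Proof.
intros [P [H1 [H2 H3]]] H. exists P. split; auto. split; auto.
eapply nle_triangle; eauto using radm.
Qed.

End Words.

(** * Generators on a coordinate ray *)

Section Ray.
(* The ray [z, 2 z, ...] on the coordinate [i], where [z = 1] or [z = -1]. *)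
Context (i : nat) (z : Z).
Hypothesis Hi : (i < n)%nat.
Hypothesis Hz : z = 1%Z \/ z = (-1)%Z.

Definition ray (j : nat) : mindex := map (fun i' => if Nat.eqb i' i then (z * Z.of_nat j)%Z else 0%Z) (seq 0 n).
(** The norm of [y] at level [p]. On the negative ray [y = x_i^-1] has norm [1 / rho_i], so on both
    rays the radius increases with [p]. *)
Definition rrad (p : nat) : R := if Z.ltb z 0 then / rs p i else ts p i.

Lemma rrad_pos p : 0 < rrad p.
Proof.
destruct (radm p i Hi). unfold rrad. destruct (Z.ltb z 0); [apply Rinv_0_lt_compat|]; lra.
Qed.

Lemma rrad_lt p : rrad p < rrad (S p).
Proof.
unfold rrad. destruct (Z.ltb z 0); [|apply tseq_lt; auto].
destruct (radm p i Hi), (radm (S p) i Hi). apply Rinv_lt_contravar.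
- apply Rmult_lt_0_compat; auto.
- apply rseq_lt; auto.
Qed.

Lemma wfac_ray p j : wfac (rs p i) (ts p i) (z * Z.of_nat j) = rrad p ^ j.
Proof.
destruct (radm p i Hi). unfold wfac, rrad. destruct Hz as [-> | ->];
  [change (Z.ltb 1 0) with false | change (Z.ltb (-1) 0) with true]; cbv iota.
- replace (1 * Z.of_nat j)%Z with (Z.of_nat j) by lia.
  destruct (Z.ltb_spec (Z.of_nat j) 0); [lia|]. now rewrite pow_powerRZ.
- replace (-1 * Z.of_nat j)%Z with (- Z.of_nat j)%Z by lia. rewrite pow_inv, pow_powerRZ.
  destruct (Z.ltb_spec (- Z.of_nat j) 0).
  + now rewrite powerRZ_neg'.
  + destruct j; [|lia]. simpl. now rewrite Rinv_1.
Qed.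

Lemma length_ray j : length (ray j) = n.
Proof. unfold ray. now rewrite length_map, length_seq. Qed.

Lemma kcoord_ray j i' : (i' < n)%nat ->
  kcoord (ray j) i' = if Nat.eqb i' i then (z * Z.of_nat j)%Z else 0%Z.
Proof. intro H. unfold ray. now rewrite kcoord_map_seq. Qed.

Lemma lprod_single c L : NoDup L ->
  lprod (map (fun i' => if Nat.eqb i' i then c else 1) L) = if in_dec Nat.eq_dec i L then c else 1.
Proof.
induction 1 as [|x L Hx HL IH]; simpl; [reflexivity|]. rewrite IH.
destruct (Nat.eqb_spec x i) as [E|E]; destruct (Nat.eq_dec x i); try contradiction;
  destruct (in_dec Nat.eq_dec i L); try ring; congruence.
Qed.

(** The weight is multiplicative here, not just submultiplicative, because the two indices have
    disjoint supports. *)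
Lemma lw_ray_vadd p j k : kcoord k i = 0%Z -> lw p (vadd n (ray j) k) = rrad p ^ j * lw p k.
Proof.
intro Hk. unfold lw. rewrite !weight_lprod.
transitivity (lprod (map (fun i' => (if Nat.eqb i' i then rrad p ^ j else 1) *
   wfac (rs p i') (ts p i') (kcoord k i')) (seq 0 n))).
- f_equal. apply map_ext_in. intros i' Hi'. apply in_seq in Hi'.
  rewrite kcoord_vadd, kcoord_ray by lia. destruct (Nat.eqb_spec i' i) as [->|].
  + rewrite Hk, Z.add_0_r, wfac_ray. unfold wfac at 1; simpl. ring.
  + rewrite Z.add_0_l. ring.
- rewrite lprod_mult, lprod_single by apply seq_NoDup.
  destruct (in_dec Nat.eq_dec i (seq 0 n)) as [|H]; [reflexivity|].
  elim H. apply in_seq. lia.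
Qed.

Lemma lw_ray p j : lw p (ray j) = rrad p ^ j.
Proof.
rewrite <- (vadd_zero_r n (ray j)) by apply length_ray.
rewrite lw_ray_vadd by apply kcoord_zero. unfold lw at 1. rewrite weight_zero. ring.
Qed.

Lemma InA_ray j : A (mono (ray j)).
Proof. apply InA_mono, length_ray. Qed.

Lemma lev_ray p j : lev p (mono (ray j)) (rrad p ^ j).
Proof. rewrite <- lw_ray. apply nle_mono, radm. Qed.

(** The left monomial lives on coordinate [i] and the right one vanishes below [i]: the product is
    already in normal order and [theta] is 1. *)
Lemma ray_mul j j' k : length k = n -> (forall i', (i' <= i)%nat -> kcoord k i' = 0%Z) ->
  cmul n q (mono (ray j)) (mono (vadd n (ray j') k)) = mono (vadd n (ray (j + j')) k).
Proof.
intros Hk Hk0. rewrite cmul_mono by auto using length_ray, length_vadd.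
rewrite theta_1.
- replace (vadd n (ray j) (vadd n (ray j') k)) with (vadd n (ray (j + j')) k).
  + extensionality m. unfold cscale. ring.
  + apply (mindex_ext n); auto using length_vadd. intros i' Hi'.
    rewrite !kcoord_vadd, !kcoord_ray by auto. destruct (Nat.eqb i' i); lia.
- intros a b Hab. rewrite kcoord_vadd, !kcoord_ray by lia.
  destruct (Nat.eqb_spec a i) as [->|]; [|lia]. destruct (Nat.eqb_spec b i); [lia|].
  rewrite Hk0 by lia. lia.
Qed.

Context (tq : nat -> R).
Hypothesis htq : forall m, 0 < tq m.
Context (ns : nat -> nat).
Notation b := (lac rrad ns).
Hypothesis hsmall : forall l, b l (rrad (3 * l - 1)) <= (/2) ^ l.
Hypothesis hdom : forall l,
    lsumR (fun j => b j (rrad (3 * l + 1))) (seq 0 l) + 1 + tq l <= b l (rrad (3 * l + 1)).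
Hypothesis hdom' : forall l,
    2 * (lsumR (fun j => b j (rrad (3 * l + 4))) (seq 0 (S l)) +
         lsumR (fun j => b j (rrad (3 * l + 5))) (seq 0 l) + 4)
      <= b l (rrad (3 * l + 5)).

(** Terms of the other parity get coefficient zero instead of being skipped, so both series run over
    all [l]; [true] selects even [l]. *)
Definition lcoef (par : bool) (l : nat) : R :=
  if Bool.eqb (Nat.even l) par then (/ rrad (3 * l)) ^ ns l else 0.
Definition lpart (par : bool) (L : list nat) : coef :=
  lsumA (fun l => cscale (lcoef par l, 0) (mono (ray (ns l)))) L.

Lemma lcoef_nonneg par l : 0 <= lcoef par l.
Proof.
unfold lcoef. destruct (Bool.eqb _ _); [|lra]. apply pow_le, Rlt_le, Rinv_0_lt_compat, rrad_pos.
Qed.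

Lemma lac_nonneg l p : 0 <= b l (rrad p).
Proof. apply pow_le, Rlt_le, Rdiv_lt_0_compat; apply rrad_pos. Qed.

Lemma lcoef_lac par l p : lcoef par l * rrad p ^ ns l <= b l (rrad p).
Proof.
unfold lcoef. destruct (Bool.eqb _ _).
- rewrite <- Rpow_mult_distr. unfold lac, Rdiv. rewrite (Rmult_comm (/ _)). lra.
- rewrite Rmult_0_l. apply lac_nonneg.
Qed.

Lemma lcoef_lac_even l p : lcoef (Nat.even l) l * rrad p ^ ns l = b l (rrad p).
Proof.
unfold lcoef. rewrite Bool.eqb_reflx, <- Rpow_mult_distr. unfold lac, Rdiv.
now rewrite (Rmult_comm (/ _)).
Qed.

Lemma lac_tail l p : (p <= 3 * l - 1)%nat -> b l (rrad p) <= (/2) ^ l.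
Proof.
intro H. eapply Rle_trans; [|apply hsmall]. apply pow_incr. split.
- apply Rlt_le, Rdiv_lt_0_compat; apply rrad_pos.
- apply Rmult_le_compat_r; [apply Rlt_le, Rinv_0_lt_compat, rrad_pos|].
  apply increasing_le; auto using rrad_lt.
Qed.

Lemma InA_lterm par l : A (cscale (lcoef par l, 0) (mono (ray (ns l)))).
Proof. apply InA_cscale, InA_ray. Qed.

Lemma InA_lpart par L : A (lpart par L).
Proof. apply InA_lsumA. intros; apply InA_lterm. Qed.

Lemma Cmod_lcoef par l : Cmod (lcoef par l, 0) = lcoef par l.
Proof. rewrite Cmod_real. apply Rabs_right, Rle_ge, lcoef_nonneg. Qed.

Lemma lev_lpart par L p : lev p (lpart par L) (lsumR (fun l => b l (rrad p)) L).
Proof.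
apply nle_lsumA; [apply radm|]. intros l _.
eapply nle_weaken; [apply nle_scale, lev_ray|]. rewrite Cmod_lcoef. apply lcoef_lac.
Qed.

Lemma lpart_app par L L' : lpart par (L ++ L') = cadd (lpart par L) (lpart par L').
Proof. apply lsumA_app. Qed.

Lemma lpart_tail par p a k : (p <= 3 * a - 1)%nat -> lev p (lpart par (seq a k)) (2 * (/2) ^ a).
Proof.
intro H. eapply nle_weaken; [apply lev_lpart|].
eapply Rle_trans; [|apply (geom_half a k)]. apply lsumR_le. intros l Hl. apply in_seq in Hl.
apply lac_tail. lia.
Qed.

(** At level [p] the terms with [3 l - 1 >= p] are at most [(/2) ^ l], so the partial sums are
    Cauchy in every norm at once. *)
Lemma lpart_limit par : exists g, A g /\ forall p eps, 0 < eps -> exists L0, forall L, (L0 <= L)%nat ->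
  lev p (csub g (lpart par (seq 0 L))) eps.
Proof.
assert (HC : forall p eps, 0 < eps -> exists M, forall m m', (M <= m)%nat -> (m <= m')%nat ->
  lev p (csub (lpart par (seq 0 m')) (lpart par (seq 0 m))) eps).
{ intros p eps He. destruct (pow_small (/2) (eps / 2)) as [M HM]; [lra | lra |].
  exists (M + p + 1)%nat. intros m m' Hm Hm'. replace m' with (m + (m' - m))%nat by lia.
  rewrite seq_app, lpart_app, Nat.add_0_l.
  replace (csub (cadd (lpart par (seq 0 m)) (lpart par (seq m (m' - m)))) (lpart par (seq 0 m)))
    with (lpart par (seq m (m' - m))) by (extensionality k; unfold csub, cadd; ring).
  eapply nle_weaken; [apply lpart_tail; lia|]. specialize (HM m ltac:(lia)). lra. }
destruct (InA_complete (fun L => lpart par (seq 0 L))) as [g [Hg Hlim]].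
- intro; apply InA_lpart.
- intros rho tau Had eps He. destruct (adm_lev rho tau Had) as [p Hp].
  destruct (HC p eps He) as [M HM]. exists M. intros m m' Hm Hm'. apply (Hp p (Nat.le_refl _)).
  destruct (Nat.le_ge_cases m m').
  + apply nle_sym. apply HM; auto.
  + apply HM; auto.
- exists g. split; auto. intros p eps He.
  destruct (Hlim _ _ (adm_seq p) eps He) as [L0 HL0]. exists L0. intros L HL.
  apply nle_sym. now apply HL0.
Qed.

(** * One level: solving for y^(n_m) in a lacunary generator *)

Section Step.
Context (g : bool -> coef).
Hypothesis Hg : forall par, A (g par).
Hypothesis Hglim : forall par p eps, 0 < eps -> exists L0, forall L, (L0 <= L)%nat ->
  lev p (csub (g par) (lpart par (seq 0 L))) eps.
Context (N : nat) (gens : nat -> coef).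
Hypothesis hgens : forall a, (a < N)%nat -> A (gens a).
Context (ly : nat) (lg : bool -> nat).
Hypothesis Hly : (ly < N)%nat /\ gens ly = mono (ray 1).
Hypothesis Hlg : forall par, (lg par < N)%nat /\ gens (lg par) = g par.
Context (m : nat).

Notation par := (Nat.even m).
Notation sg := (rrad (3 * m + 1)).
Notation sg' := (rrad (3 * m + 4)).
Notation sg'' := (rrad (3 * m + 5)).
Notation low x := (lsumR (fun j => b j x) (seq 0 m)).
Notation Ap := (Appr N gens (tq m) (3 * m + 4)).

(** Index [m] is left out because its term is the one being solved for. *)
Definition rest (L : nat) : list nat := seq 0 m ++ seq (S m) (L - S m).

(** Term [m + 1] has the wrong parity and vanishes. From [m + 2] on, [p <= 3 m + 5 <= 3 l - 1]
    bounds the terms by [(/2) ^ l], hence their total by 1. *)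
Lemma rest_bound L p : (p <= 3 * m + 5)%nat ->
  lsumR (fun l => lcoef par l * rrad p ^ ns l) (rest L) <= lsumR (fun j => b j (rrad p)) (seq 0 m) + 1.
Proof.
intro Hp. unfold rest. rewrite lsumR_app. apply Rplus_le_compat.
- apply lsumR_le. intros; apply lcoef_lac.
- apply Rle_trans with (lsumR (fun l => (/2) ^ l) (seq (S m) (L - S m))).
  + apply lsumR_le. intros l Hl. apply in_seq in Hl.
    destruct (Nat.eq_dec l (S m)) as [->|].
    * unfold lcoef. rewrite Nat.even_succ, <- Nat.negb_even.
      destruct (Nat.even m); simpl Bool.eqb; cbv iota; rewrite Rmult_0_l; apply pow_le; lra.
    * eapply Rle_trans; [apply lcoef_lac|]. apply lac_tail. lia.
  + eapply Rle_trans; [apply geom_half|].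
    assert ((/2) ^ m <= 1) by (rewrite <- (pow1 m); apply pow_incr; lra). simpl. lra.
Qed.

Lemma lpart_split L : (S m <= L)%nat ->
  lpart par (seq 0 L) = cadd (cscale (lcoef par m, 0) (mono (ray (ns m)))) (lpart par (rest L)).
Proof.
intro HL. replace L with (m + S (L - S m))%nat at 1 by lia.
rewrite seq_app. unfold rest. rewrite !lpart_app. simpl seq. unfold lpart at 2. rewrite lsumA_cons.
fold (lpart par (seq (S m) (L - S m))). extensionality k; unfold cadd; ring.
Qed.

(** Of the 2, one unit is the tail in [rest_bound], the other the distance from the generator to its
    partial sum. *)
Lemma lev_g : lev (3 * m + 4) (g par) (lsumR (fun j => b j sg') (seq 0 (S m)) + 2).
Proof.
destruct (Hglim par (3 * m + 4) 1 ltac:(lra)) as [L0 HL0].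
specialize (HL0 (S m + L0)%nat ltac:(lia)).
pose proof (lpart_split (S m + L0) ltac:(lia)) as E. rewrite E in HL0.
assert (H1 : lev (3 * m + 4) (cadd (cscale (lcoef par m, 0) (mono (ray (ns m))))
   (lpart par (rest (S m + L0)))) (lsumR (fun j => b j sg') (seq 0 (S m)) + 1)).
{ rewrite seq_S, lsumR_app. eapply nle_weaken.
  - apply lev_add.
    + apply nle_scale, lev_ray.
    + apply nle_lsumA; [apply radm|]. intros l _. apply nle_scale, lev_ray.
  - pose proof (rest_bound (S m + L0) (3 * m + 4) ltac:(lia)) as T.
    rewrite Cmod_lcoef, lcoef_lac_even.
    rewrite (lsumR_ext _ (fun l => lcoef par l * sg' ^ ns l)) by (intros; now rewrite Cmod_lcoef).
    change (lsumR (fun j => b j sg') [(0 + m)%nat]) with (b m sg' + 0). lra. }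
pose proof (lev_add _ _ _ _ _ HL0 H1) as T.
eapply nle_weaken; [eapply ub_le; [|exact T]|].
- intro k. right. simpl. f_equal. f_equal. unfold cadd, csub. ring.
- lra.
Qed.

Section Base.
Context (k : mindex) (c : R).
Hypothesis Hk : length k = n.
Hypothesis Hk0 : forall i', (i' <= i)%nat -> kcoord k i' = 0%Z.
Hypothesis Hc : 0 <= c.
Hypothesis Happ : forall eps, 0 < eps -> Ap (mono k) c eps.

Notation Xk j := (mono (vadd n (ray j) k)).

Lemma InA_Xk j : A (Xk j).
Proof. apply InA_mono, length_vadd. Qed.

Lemma lev_Xk p j : lev p (Xk j) (rrad p ^ j * lw p k).
Proof. rewrite <- lw_ray_vadd by (apply Hk0; lia). apply nle_mono, radm. Qed.

Lemma Xk_0 : Xk 0 = mono k.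
Proof.
f_equal. apply (mindex_ext n); auto using length_vadd. intros i' Hi'.
rewrite kcoord_vadd, kcoord_ray by auto. destruct (Nat.eqb i' i); lia.
Qed.

(** Words in [y] alone. Their cost [tq m ^ j] is acceptable for the finitely many [j < n_m], where
    [stepD] absorbs it. *)
Lemma Appr_small j eps : 0 < eps -> Ap (Xk j) (tq m ^ j * c) (sg' ^ j * eps).
Proof.
intro He. induction j as [|j IH].
- rewrite Xk_0. simpl. rewrite !Rmult_1_l. auto.
- pose proof (ray_mul 1 j k Hk Hk0) as E. simpl (1 + j)%nat in E. rewrite <- E.
  destruct Hly as [Hly1 Hly2]. rewrite <- Hly2.
  eapply Appr_weaken.
  + apply Appr_lmul with (G := sg'); eauto using InA_Xk.
    * apply Rlt_le, htq.
    * rewrite Hly2. replace sg' with (sg' ^ 1) by ring. apply lev_ray.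
  + simpl. lra.
  + simpl. lra.
Qed.

(** Bounds [(tq m / sg) ^ j] for all [j < n_m] together; a sum stands in for the maximum. *)
Definition stepD : R := 1 + lsumR (fun j => (tq m / sg) ^ j) (seq 0 (ns m)).

Lemma stepD_nonneg : 0 <= stepD.
Proof.
unfold stepD. assert (0 <= lsumR (fun j => (tq m / sg) ^ j) (seq 0 (ns m))); [|lra].
apply lsumR_nonneg. intros. apply pow_le, Rlt_le, Rdiv_lt_0_compat; auto using rrad_pos.
Qed.

Lemma stepD_ge j : (j < ns m)%nat -> tq m ^ j <= stepD * sg ^ j.
Proof.
intro Hj. assert (Hs := rrad_pos (3 * m + 1)).
assert (T : (tq m / sg) ^ j <= stepD).
{ unfold stepD. pose proof (lsumR_incl (fun j => (tq m / sg) ^ j) [j] (seq 0 (ns m))) as T.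
  simpl in T. assert (HN : NoDup [j]) by (constructor; [easy | constructor]).
  assert (HI : incl [j] (seq 0 (ns m))) by (intros x [<-|[]]; apply in_seq; lia).
  specialize (T ltac:(intros; apply pow_le, Rlt_le, Rdiv_lt_0_compat; auto) HN
    (seq_NoDup _ _) HI). simpl in *. lra. }
apply Rmult_le_compat_r with (r := sg ^ j) in T; [|apply pow_le; lra].
rewrite <- Rpow_mult_distr in T. replace (tq m / sg * sg) with (tq m) in T by (field; lra). exact T.
Qed.

(* [z^(n_m)] solved from the lacunary generator of the parity of [m], the series being cut at [L]. *)
Lemma ray_identity L d : (S m <= L)%nat ->
  Xk (ns m + d) = cadd (cscale (/ lcoef par m, 0) (csub (cmul n q (g par) (Xk d))
     (lsumA (fun l => cscale (lcoef par l, 0) (Xk (ns l + d))) (rest L))))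
   (cscale (- / lcoef par m, 0) (cmul n q (csub (g par) (lpart par (seq 0 L))) (Xk d))).
Proof.
intro HL.
assert (Ha : 0 < lcoef par m).
{ unfold lcoef. rewrite Bool.eqb_reflx. apply pow_lt, Rinv_0_lt_compat, rrad_pos. }
assert (E : forall l, cmul n q (cscale (lcoef par l, 0) (mono (ray (ns l)))) (Xk d) =
   cscale (lcoef par l, 0) (Xk (ns l + d))).
{ intro l. rewrite cmulA_scalel, ray_mul; auto using InA_ray, InA_Xk. }
assert (E1 : cmul n q (lpart par (rest L)) (Xk d) =
   lsumA (fun l => cscale (lcoef par l, 0) (Xk (ns l + d))) (rest L)).
{ unfold lpart. rewrite cmulA_lsuml by (intros; auto using InA_lterm, InA_Xk).
  apply lsumA_ext. intros; apply E. }
rewrite (csub_scale (g par)), cmulA_addl, (cmulA_scalel _ (lpart _ _)), lpart_split, cmulA_addl, E, E1;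
  auto using InA_lpart, InA_Xk, InA_cscale, InA_ray, InA_cadd.
extensionality x. unfold cadd, csub, cscale.
set (u := cmul n q (g par) (Xk d) x). set (v := lsumA _ _ x). set (y := Xk (ns m + d) x).
apply injective_projections; simpl; field; lra.
Qed.

(* Induction on the number [I] of substitutions of [ray_identity]. The error is measured at the
   radius [sg'], but compared with powers of the larger radius [sg''], at which the [m]-th term
   dominates even the terms of [g] that multiply the error: this makes each substitution contract. *)
Lemma ray_step_depth I j : Ap (Xk j) (stepD * sg ^ j * c) ((/2) ^ I * lw (3 * m + 4) k * sg'' ^ j).
Proof.
set (W := lw (3 * m + 4) k).
assert (HW : 0 < W) by apply lw_pos.
assert (Hs := rrad_pos (3 * m + 1)). assert (Hs' := rrad_pos (3 * m + 4)).
assert (Hs'' := rrad_pos (3 * m + 5)).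
assert (Hle : forall e, sg' ^ e <= sg'' ^ e).
{ intro e. apply pow_incr. split; [lra|]. apply increasing_le; auto using rrad_lt; lia. }
assert (HD := stepD_nonneg).
assert (Hcost : forall e, 0 <= stepD * sg ^ e * c).
{ intro e. apply Rmult_le_pos; auto. apply Rmult_le_pos; auto. apply pow_le; lra. }
(* [j] is generalised because terms of index above [m] raise the exponent, so a descent in [j] is
   impossible. *)
revert j. induction I as [|I IH]; intro j.
(* With no substitution the zero polynomial is taken, and the error is the monomial itself. *)
- eapply Appr_weaken; [apply Appr_zero, lev_Xk | apply Hcost |].
  rewrite pow_O. fold W. specialize (Hle j). nra.
- assert (HI : 0 < (/2) ^ I) by (apply pow_lt; lra).
  assert (HI1 : (/2) ^ I <= 1) by (rewrite <- (pow1 I); apply pow_incr; lra).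
  assert (HIW : 0 < (/2) ^ I * W) by (apply Rmult_lt_0_compat; auto).
  destruct (Nat.lt_ge_cases j (ns m)) as [Hj|Hj].
  (* Below [n_m] no substitution is made: words in [y] reach any accuracy. *)
  + eapply Appr_weaken; [apply (Appr_small j ((/2) ^ S I * W)) | |].
    * simpl. lra.
    * apply Rmult_le_compat_r; auto. now apply stepD_ge.
    * rewrite Rmult_comm. apply Rmult_le_compat_l; auto. simpl. lra.
  + replace j with (ns m + (j - ns m))%nat by lia. set (d := (j - ns m)%nat). clearbody d. clear j Hj.
    (* The cut is chosen depending on [I], so that what [g] loses by it is no larger than the errors
       inherited from the induction. *)
    destruct (Hglim par (3 * m + 4) ((/2) ^ I) HI) as [L0 HL0].
    specialize (HL0 (S m + L0)%nat ltac:(lia)). set (L := (S m + L0)%nat) in *.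
    assert (Ha : 0 < lcoef par m).
    { unfold lcoef. rewrite Bool.eqb_reflx. apply pow_lt, Rinv_0_lt_compat, rrad_pos. }
    set (a := lcoef par m) in *.
    set (e := (/2) ^ I * W * sg'' ^ d).
    assert (He : 0 < e) by (apply Rmult_lt_0_compat; auto; apply pow_lt; lra).
    set (G := lsumR (fun j => b j sg') (seq 0 (S m)) + 2).
    set (Ra := fun x => lsumR (fun l => lcoef par l * x ^ ns l) (rest L)).
    assert (H1 : Ap (cmul n q (g par) (Xk d)) (tq m * (stepD * sg ^ d * c)) (G * e)).
    { destruct (Hlg par) as [Hl1 Hl2]. rewrite <- Hl2. apply Appr_lmul; auto using InA_Xk.
      - apply Rlt_le, htq.
      - rewrite Hl2. apply lev_g. }
    assert (H2 : Ap (lsumA (fun l => cscale (lcoef par l, 0) (Xk (ns l + d))) (rest L))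
        (Ra sg * (stepD * sg ^ d * c)) (Ra sg'' * e)).
    { eapply Appr_weaken.
      - apply Appr_sum. intros l _. apply Appr_scale, IH.
      - right. rewrite (Rmult_comm (Ra _)). unfold Ra. rewrite <- lsumR_scal. apply lsumR_ext. intros l _.
        rewrite Cmod_lcoef, pow_add. ring.
      - right. rewrite (Rmult_comm (Ra _)). unfold Ra. rewrite <- lsumR_scal. apply lsumR_ext. intros l _.
        rewrite Cmod_lcoef, pow_add. unfold e. ring. }
    assert (H3 : lev (3 * m + 4) (cmul n q (csub (g par) (lpart par (seq 0 L))) (Xk d))
        ((/2) ^ I * (sg' ^ d * W))).
    { apply nle_mul; auto using radm. apply lev_Xk. }
    pose proof (Appr_scale _ _ _ _ _ _ _ (/ a, 0) (Appr_sub _ _ _ _ _ _ _ _ _ _ H1 H2)) as H4.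
    apply (nle_scale n _ _ (- / a, 0)) in H3.
    rewrite (ray_identity L d) by lia. fold a.
    assert (Hia : 0 < / a) by (now apply Rinv_0_lt_compat).
    rewrite Cmod_real, Rabs_right in H4 by lra.
    rewrite Cmod_real, Rabs_Ropp, Rabs_right in H3 by lra.
    eapply Appr_weaken.
    * eapply Appr_close; [exact H4|].
      replace (csub (cadd (cscale (/ a, 0) (csub (cmul n q (g par) (Xk d))
         (lsumA (fun l => cscale (lcoef par l, 0) (Xk (ns l + d))) (rest L))))
        (cscale (- / a, 0) (cmul n q (csub (g par) (lpart par (seq 0 L))) (Xk d))))
        (cscale (/ a, 0) (csub (cmul n q (g par) (Xk d))
         (lsumA (fun l => cscale (lcoef par l, 0) (Xk (ns l + d))) (rest L)))))
       with (cscale (- / a, 0) (cmul n q (csub (g par) (lpart par (seq 0 L))) (Xk d)))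
       by (extensionality x; unfold csub, cadd, cscale; ring).
      exact H3.
    (* Cost: the letter [g] contributes the factor [tq m] and the remaining terms [Ra sg]; by [hdom]
       their sum is at most the [m]-th term, so the constant [stepD] is reproduced. *)
    * pose proof (hdom m) as T. rewrite <- lcoef_lac_even in T. fold a in T.
      pose proof (rest_bound L (3 * m + 1) ltac:(lia)) as T2. fold (Ra sg) in T2.
      apply (Rmult_le_reg_l a); auto. rewrite <- Rmult_assoc, Rinv_r, Rmult_1_l by lra.
      rewrite pow_add.
      replace (a * (stepD * (sg ^ ns m * sg ^ d) * c)) with (a * sg ^ ns m * (stepD * sg ^ d * c)) by ring.
      rewrite <- Rmult_plus_distr_r. apply Rmult_le_compat_r; auto. lra.
    (* Error, in units of [e]: the cut contributes 1, [G] carries a 2 and the bound for [Ra sg''] a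
       1, which is the 4 in [hdom']. The factor 2 there yields the gain of one half. *)
    * pose proof (hdom' m) as T. rewrite <- (lcoef_lac_even m (3 * m + 5)) in T. fold a in T.
      pose proof (rest_bound L (3 * m + 5) ltac:(lia)) as T2. fold (Ra sg'') in T2.
      assert (T3 : (/2) ^ I * (sg' ^ d * W) <= e).
      { unfold e. rewrite (Rmult_comm (sg' ^ d)), <- Rmult_assoc. apply Rmult_le_compat_l; auto. lra. }
      apply (Rmult_le_reg_l a); auto.
      rewrite Rmult_plus_distr_l, <- !(Rmult_assoc a), Rinv_r, !Rmult_1_l by lra.
      replace (a * (/2) ^ S I * W * sg'' ^ (ns m + d)) with (/ 2 * (a * sg'' ^ ns m) * e)
        by (unfold e; rewrite pow_add; simpl; ring).
      unfold G.
      assert (T4 : (1 + (lsumR (fun j => b j sg') (seq 0 (S m)) + 2) + Ra sg'') * e <=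
         / 2 * (a * sg'' ^ ns m) * e) by (apply Rmult_le_compat_r; lra).
      lra.
Qed.

(** The cost in [ray_step_depth] does not depend on [I], so substitutions can be repeated until the
    error is below [eps]. *)
Lemma ray_step j eps : 0 < eps -> Ap (Xk j) (stepD * sg ^ j * c) eps.
Proof.
intro He. set (K := lw (3 * m + 4) k * sg'' ^ j).
assert (HK : 0 < K) by (apply Rmult_lt_0_compat; [apply lw_pos | apply pow_lt, rrad_pos]).
destruct (pow_small (/2) (eps / K)) as [I HI]; [lra | now apply Rdiv_lt_0_compat |].
eapply Appr_weaken; [apply (ray_step_depth I) | lra |].
specialize (HI I (Nat.le_refl _)).
rewrite Rmult_assoc. fold K. apply Rmult_le_compat_r with (r := K) in HI; [|lra].
replace (eps / K * K) with eps in HI by (field; lra). exact HI.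
Qed.

End Base.
End Step.
End Ray.

(** * Surjectivity of the free functional calculus *)

(** The weight of a letter at level [m]; it tends to infinity so that the limit series is entire. *)
Definition tq (m : nat) : R := INR m + 1.

Lemma tq_pos m : 0 < tq m.
Proof. unfold tq. pose proof (pos_INR m). lra. Qed.

(** The enumeration may contain further elements, so the generators found for the single rays can be
    pooled in one list. *)
Definition covers (N : nat) (gens : nat -> coef) (S : list coef) : Prop :=
  (forall a, (a < N)%nat -> A (gens a)) /\ (forall s, In s S -> exists a, (a < N)%nat /\ gens a = s).

(** The inductive step over coordinates: approximability of [x^k] passes to its products with powers
    along the ray. The factor [D] depends on [m] only, not on [k], [c], [j] or [eps]. *)
Definition ray_property (N : nat) (gens : nat -> coef) (i : nat) (z : Z) : Prop :=
  forall m, exists D, 0 <= D /\ forall k c, length k = n ->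
    (forall i', (i' <= i)%nat -> kcoord k i' = 0%Z) -> 0 <= c ->
    (forall eps, 0 < eps -> Appr N gens (tq m) (3 * m + 4) (mono k) c eps) ->
    forall j eps, 0 < eps ->
    Appr N gens (tq m) (3 * m + 4) (mono (vadd n (ray i z j) k)) (D * rrad i z (3 * m + 1) ^ j * c) eps.

Lemma ray_generators i z : (i < n)%nat -> z = 1%Z \/ z = (-1)%Z ->
  exists S, (forall s, In s S -> A s) /\ forall N gens, covers N gens S -> ray_property N gens i z.
Proof.
intros Hi Hz.
destruct (lacunary (rrad i z) tq) as [ns Hns].
{ intro; now apply rrad_pos. } { intro; now apply rrad_lt. }
destruct (choice _ (lpart_limit i z Hi Hz ns (fun l => proj1 (Hns l)))) as [g Hg].
exists [mono (ray i z 1); g true; g false]. split.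
- intros s [<-|[<-|[<-|[]]]]; [now apply InA_ray | apply Hg | apply Hg].
- intros N gens [HA HC] m.
  destruct (HC (mono (ray i z 1)) ltac:(simpl; auto)) as [ly Hly].
  destruct (HC (g true) ltac:(simpl; auto)) as [l1 Hl1].
  destruct (HC (g false) ltac:(simpl; auto)) as [l2 Hl2].
  exists (stepD i z tq ns m). split; [apply stepD_nonneg; auto using tq_pos|].
  intros k c Hk Hk0 Hc Happ.
  apply (ray_step i z Hi Hz tq tq_pos ns (fun l => proj1 (Hns l))
    (fun l => proj1 (proj2 (Hns l))) (fun l => proj2 (proj2 (Hns l))) g
    (fun par => proj1 (Hg par)) (fun par => proj2 (Hg par)) N gens HA ly
    (fun par : bool => if par then l1 else l2)); auto.
  now intros [|].
Qed.

Lemma covers_app N gens S S' : covers N gens (S ++ S') -> covers N gens S /\ covers N gens S'.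
Proof.
intros [H1 H2]. split; (split; [exact H1|]); intros s Hs; apply H2, in_app_iff; auto.
Qed.

Lemma all_generators : exists S, (forall s, In s S -> A s) /\ forall N gens, covers N gens S ->
  forall i z, (i < n)%nat -> z = 1%Z \/ z = (-1)%Z -> ray_property N gens i z.
Proof.
assert (K : forall d, (d <= n)%nat -> exists S, (forall s, In s S -> A s) /\
  forall N gens, covers N gens S ->
  forall i z, (i < d)%nat -> z = 1%Z \/ z = (-1)%Z -> ray_property N gens i z).
{ induction d as [|d IH]; intro Hd.
  - exists []. split; [easy | lia].
  - destruct (IH ltac:(lia)) as [S [HS1 HS2]].
    destruct (ray_generators d 1 Hd ltac:(auto)) as [S1 [HS3 HS4]].
    destruct (ray_generators d (-1) Hd ltac:(auto)) as [S2 [HS5 HS6]].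
    exists (S ++ S1 ++ S2). split.
    + intros s Hs. rewrite !in_app_iff in Hs. destruct Hs as [|[|]]; auto.
    + intros N gens HC. apply covers_app in HC. destruct HC as [C1' HC].
      apply covers_app in HC. destruct HC as [C2' C3'].
      intros i z Hi Hz. destruct (Nat.eq_dec i d) as [->|].
      * destruct Hz as [-> | ->]; auto.
      * apply HS2; auto. lia. }
exact (K n (Nat.le_refl n)).
Qed.

Section Surjectivity.
Context (N : nat) (gens : nat -> coef).
Hypothesis hgens : forall a, (a < N)%nat -> A (gens a).
Hypothesis hray : forall i z, (i < n)%nat -> z = 1%Z \/ z = (-1)%Z -> ray_property N gens i z.

Notation we := (word_eval n q gens).
Notation Ap m := (Appr N gens (tq m) (3 * m + 4)).
Notation evP := (ev gens).

(* The coordinates are treated from the last to the first, so that every generator is multiplied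
   from the left onto a monomial in later coordinates and no factor [theta] appears. *)
Lemma Appr_mono_below m d i : (i + d = n)%nat -> exists C, 0 <= C /\ forall k, length k = n ->
  (forall i', (i' < i)%nat -> kcoord k i' = 0%Z) ->
  forall eps, 0 < eps -> Ap m (mono k) (C * lw (3 * m + 1) k) eps.
Proof.
revert i. induction d as [|d IH]; intros i Hid.
(* The unit monomial is the empty word, of cost 1. *)
- exists 1. split; [lra|]. intros k Hk Hk0 eps He.
  assert (k = zero_index n) as ->.
  { apply (mindex_ext n); auto using length_zero. intros i' Hi'. rewrite kcoord_zero. apply Hk0; lia. }
  exists [(C1, [])]. split; [|split].
  + intros cw [<-|[]] a [].
  + unfold cost, lw. simpl lsumR. rewrite weight_zero, Cmod_C1. simpl; lra.
  + replace (csub (mono (zero_index n)) (evP [(C1, [])])) with czero.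
    * apply nle_zero; lra.
    * extensionality x. change (C0 = Csub (mono (zero_index n) x)
        (Cadd (Cmul C1 (mono (zero_index n) x)) C0)). ring.
- destruct (IH (S i) ltac:(lia)) as [C [HC HT]].
  assert (Hi : (i < n)%nat) by lia.
  destruct (hray i 1 Hi ltac:(auto) m) as [D1 [HD1 H1]].
  destruct (hray i (-1) Hi ltac:(auto) m) as [D2 [HD2 H2]].
  (* [D1 + D2] serves whichever sign the exponent at [i] has. *)
  exists ((D1 + D2) * C). split; [apply Rmult_le_pos; lra|]. intros k Hk Hk0 eps He.
  set (k' := map (fun i' => if Nat.eqb i' i then 0%Z else kcoord k i') (seq 0 n)).
  set (z := if Z.ltb (kcoord k i) 0 then (-1)%Z else 1%Z).
  set (j := Z.abs_nat (kcoord k i)).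
  assert (Hz : z = 1%Z \/ z = (-1)%Z) by (unfold z; destruct (Z.ltb _ 0); auto).
  assert (Hk' : length k' = n) by (unfold k'; now rewrite length_map, length_seq).
  assert (Hk0' : forall i', (i' < S i)%nat -> kcoord k' i' = 0%Z).
  { intros i' Hi'. unfold k'. rewrite kcoord_map_seq by lia.
    destruct (Nat.eqb_spec i' i); auto. apply Hk0. lia. }
  assert (E : k = vadd n (ray i z j) k').
  { apply (mindex_ext n); auto using length_vadd. intros i' Hi'.
    rewrite kcoord_vadd, kcoord_ray by auto. unfold k'. rewrite kcoord_map_seq by auto.
    destruct (Nat.eqb_spec i' i) as [->|]; [|lia].
    unfold z, j. destruct (Z.ltb_spec (kcoord k i) 0); lia. }
  assert (Hlw : 0 <= lw (3 * m + 1) k') by (apply Rlt_le, lw_pos).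
  assert (Hc : 0 <= C * lw (3 * m + 1) k') by (now apply Rmult_le_pos).
  assert (Hr : 0 <= rrad i z (3 * m + 1) ^ j) by (apply pow_le, Rlt_le, rrad_pos; auto).
  rewrite E, lw_ray_vadd; auto.
  assert (Ha : forall i', (i' <= i)%nat -> kcoord k' i' = 0%Z) by (intros; apply Hk0'; lia).
  assert (Hb := HT k' Hk' Hk0').
  assert (Hrc : 0 <= rrad i z (3 * m + 1) ^ j * (C * lw (3 * m + 1) k')) by (now apply Rmult_le_pos).
  destruct Hz as [Ez | Ez]; rewrite Ez in *.
  + eapply Appr_weaken; [apply (H1 k' _ Hk' Ha Hc Hb j eps He) | | lra].
    rewrite Rmult_assoc.
    replace ((D1 + D2) * C * (rrad i 1 (3 * m + 1) ^ j * lw (3 * m + 1) k'))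
      with ((D1 + D2) * (rrad i 1 (3 * m + 1) ^ j * (C * lw (3 * m + 1) k'))) by ring.
    apply Rmult_le_compat_r; lra.
  + eapply Appr_weaken; [apply (H2 k' _ Hk' Ha Hc Hb j eps He) | | lra].
    rewrite Rmult_assoc.
    replace ((D1 + D2) * C * (rrad i (-1) (3 * m + 1) ^ j * lw (3 * m + 1) k'))
      with ((D1 + D2) * (rrad i (-1) (3 * m + 1) ^ j * (C * lw (3 * m + 1) k'))) by ring.
    apply Rmult_le_compat_r; lra.
Qed.

(** [f] is cut to a finite sum in the stronger norm at [3 m + 4]; whatever the cut, the costs of its
    monomials add up to at most [C] times the weaker norm bound [M]. *)
Lemma Appr_level m : exists C, 0 <= C /\ forall f M eps, A f -> lev (3 * m + 1) f M -> 0 < eps ->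
  Ap m f (C * M) eps.
Proof.
destruct (Appr_mono_below m n 0 ltac:(lia)) as [C [HC HT]]. exists C. split; auto.
intros f M eps Hf HM He.
destruct (InA_lev f (3 * m + 4) Hf) as [B HB].
destruct (nle_approx n _ _ (radm (3 * m + 4)) f B HB (eps / 2) ltac:(lra)) as [F [HF HF2]].
set (e := eps / 2 / (INR (length F) + 1)).
assert (HN : 0 < INR (length F) + 1) by (pose proof (pos_INR (length F)); lra).
assert (He' : 0 < e) by (apply Rdiv_lt_0_compat; lra).
assert (H : Ap m (lsumA (fun k => cscale (f k) (mono k)) F)
  (lsumR (fun k => C * (Cmod (f k) * lw (3 * m + 1) k)) F) (lsumR (fun _ => e) F)).
{ apply Appr_sum. intros k _. pose proof (Cmod_nonneg (f k)) as Hp.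
  destruct (Nat.eq_dec (length k) n) as [Hk|Hk].
  - eapply Appr_weaken.
    + apply Appr_scale, (HT k Hk ltac:(lia) (e / (Cmod (f k) + 1))). apply Rdiv_lt_0_compat; lra.
    + lra.
    + apply (Rmult_le_reg_r (Cmod (f k) + 1)); [lra|].
      replace (Cmod (f k) * (e / (Cmod (f k) + 1)) * (Cmod (f k) + 1)) with (Cmod (f k) * e)
        by (field; lra). nra.
  - rewrite (proj1 Hf k Hk), Cmod_C0. eapply Appr_weaken.
    + apply Appr_scale, (Appr_zero N gens (tq m) (3 * m + 4)), nle_mono, radm.
    + lra.
    + rewrite Cmod_C0; lra. }
eapply Appr_weaken; [eapply Appr_close; [exact H | exact HF2] | |].
- rewrite lsumR_scal. apply Rmult_le_compat_l; auto.
- rewrite lsumR_const. assert (INR (length F) * e <= eps / 2); [|lra].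
  unfold e. apply (Rmult_le_reg_r (INR (length F) + 1)); auto.
  replace (INR (length F) * (eps / 2 / (INR (length F) + 1)) * (INR (length F) + 1))
    with (INR (length F) * (eps / 2)) by (field; lra). nra.
Qed.

(** * Coefficients of polynomials and the limiting entire series *)

Definition coefP (P : npoly) (alpha : word) : CC :=
  lsumC (fun cw : CC * word => if eq_dec_c (snd cw) alpha then fst cw else C0) P.

Lemma coefP_app P Q alpha : coefP (P ++ Q) alpha = Cadd (coefP P alpha) (coefP Q alpha).
Proof. apply lsumC_app. Qed.

(** By the triangle inequality, collecting equal words can only lower the norm. *)
Lemma coefP_ub t P : 0 <= t -> ub (fun alpha => Cmod (coefP P alpha) * t ^ length alpha) (cost t P).
Proof.
intro Ht. induction P as [|[c w] P IH].
- apply ub_le with (g := fun _ => 0 * 0).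
  + intro alpha. unfold coefP. simpl lsumC. rewrite Cmod_C0. lra.
  + intros G HG. rewrite lsumR_scal. unfold cost; simpl; lra.
- assert (Hv : 0 <= Cmod c * t ^ length w) by (apply Rmult_le_pos; [apply Cmod_nonneg | now apply pow_le]).
  eapply ub_le; [|exact (ub_plus _ _ _ _ (ub_single w _ Hv) IH)].
  intro alpha. change (coefP ((c, w) :: P) alpha) with
    (Cadd (if eq_dec_c w alpha then c else C0) (coefP P alpha)). simpl.
  assert (0 <= t ^ length alpha) by (now apply pow_le).
  destruct (eq_dec_c w alpha) as [<-|].
  + rewrite <- Rmult_plus_distr_r. apply Rmult_le_compat_r; auto. apply Cmod_add.
  + replace (Cadd C0 (coefP P alpha)) with (coefP P alpha) by ring. lra.
Qed.

Lemma coefP_out P alpha : okP N P -> ~ okw N alpha -> coefP P alpha = C0.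
Proof.
intros HP Ha. induction P as [|[c w] P IH]; [reflexivity|].
change (Cadd (if eq_dec_c w alpha then c else C0) (coefP P alpha) = C0).
rewrite IH by (intros x Hx; apply HP; simpl; auto).
destruct (eq_dec_c w alpha) as [<-|]; [|ring]. elim Ha. apply (HP (c, w)). simpl; auto.
Qed.

Lemma lsumA_single (F : word -> coef) w G : NoDup G -> In w G ->
  lsumA (fun alpha => if eq_dec_c w alpha then F alpha else czero) G = F w.
Proof.
assert (E : forall L, ~ In w L -> lsumA (fun alpha => if eq_dec_c w alpha then F alpha else czero) L = czero).
{ induction L as [|x L IH]; intro H; [reflexivity|]. rewrite lsumA_cons, IH by (simpl in H; tauto).
  destruct (eq_dec_c w x) as [<-|]; [elim H; simpl; auto|].
  extensionality k; unfold cadd, czero; ring. }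
intros HG. induction HG as [|x G Hx HG IH]; intro Hw; [easy|]. rewrite lsumA_cons.
destruct (eq_dec_c w x) as [<-|Hn].
- rewrite E by auto. extensionality k; unfold cadd, czero; ring.
- rewrite IH by (destruct Hw; congruence). extensionality k; unfold cadd, czero; ring.
Qed.

Lemma coefP_ev P G : NoDup G -> incl (map snd P) G ->
  lsumA (fun alpha => cscale (coefP P alpha) (we alpha)) G = evP P.
Proof.
intros HG. induction P as [|[c w] P IH]; intro HI.
- replace (evP []) with (lsumA (fun _ : word => cscale C0 czero) G).
  + apply lsumA_ext. intros alpha _. extensionality k. unfold coefP, cscale, czero. simpl lsumC. ring.
  + rewrite lsumA_scale. extensionality k. unfold cscale. change (evP [] k) with C0. ring.
- change (evP ((c, w) :: P)) with (cadd (cscale c (we w)) (evP P)).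
  rewrite <- IH by (intros x Hx; apply HI; simpl; auto).
  rewrite <- (lsumA_single (fun alpha => cscale c (we alpha)) w G HG) by (apply HI; simpl; auto).
  rewrite <- lsumA_plus. apply lsumA_ext. intros alpha _.
  change (coefP ((c, w) :: P) alpha) with (Cadd (if eq_dec_c w alpha then c else C0) (coefP P alpha)).
  extensionality k. destruct (eq_dec_c w alpha); unfold cscale, cadd, czero; ring.
Qed.

Lemma lev_word p t w : 0 <= t -> (forall a, (a < N)%nat -> lev p (gens a) t) -> okw N w ->
  lev p (we w) (t ^ length w).
Proof.
intros Ht H. induction w as [|a w IH]; intro Hw.
- simpl. rewrite <- (weight_zero n (rs p) (ts p)). apply nle_mono, radm.
- apply nle_mul; auto using radm.
  + apply H, Hw. simpl; auto.
  + apply IH. intros b Hb. apply Hw. simpl; auto.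
Qed.

Lemma gens_bound p : exists t, 0 < t /\ forall a, (a < N)%nat -> lev p (gens a) t.
Proof.
clear hray. induction N as [|N' IH]; [exists 1; split; [lra | lia]|].
destruct IH as [t [Ht H]]. { intros; apply hgens; lia. }
destruct (InA_lev (gens N') p (hgens N' ltac:(lia))) as [M HM]. exists (Rmax t M). split.
- eapply Rlt_le_trans; [exact Ht | apply Rmax_l].
- intros a Ha. destruct (Nat.eq_dec a N') as [->|].
  + eapply nle_weaken; [exact HM | apply Rmax_r].
  + eapply nle_weaken; [apply H; lia | apply Rmax_l].
Qed.

(** Each correction approximates the current error, so its cost is governed by how small that error
    was made one level earlier. The bounds start at index 1, since nothing is known about the size
    of [f] itself. *)
Lemma telescope f : A f -> exists (Q : nat -> npoly),
  (forall m, okP N (Q m)) /\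
  (forall m, lev (3 * S m + 1) (csub f (evP (Q (S m)))) ((/2) ^ S m)) /\
  (forall m, exists P, Q (S (S m)) = Q (S m) ++ P /\ cost (tq (S m)) P <= (/2) ^ S m).
Proof.
intro Hf. destruct (choice _ Appr_level) as [C HC].
(* Dividing by [C m + 1] makes the next correction cost at most [(/2) ^ m], however fast [C m]
   grows. *)
set (del := fun m => (/2) ^ m / (C m + 1)).
assert (Hdel : forall m, 0 < del m).
{ intro m. destruct (HC m) as [H _]. apply Rdiv_lt_0_compat; [apply pow_lt|]; lra. }
assert (Hdel1 : forall m, C m * del m <= (/2) ^ m /\ del m <= (/2) ^ m).
{ intro m. destruct (HC m) as [H _]. assert (0 < (/2) ^ m) by (apply pow_lt; lra).
  unfold del. split; apply (Rmult_le_reg_r (C m + 1)); try lra.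
  - replace (C m * ((/2) ^ m / (C m + 1)) * (C m + 1)) with (C m * (/2) ^ m) by (field; lra). nra.
  - replace ((/2) ^ m / (C m + 1) * (C m + 1)) with ((/2) ^ m) by (field; lra). nra. }
(* Choice needs a correction for every pair, so the claims are conditional. The cost bound requires
   a small earlier error; otherwise, as may happen at the first step, just some bound [B] is
   used. *)
assert (Hstep : forall x : nat * npoly, exists P, okP N (snd x) -> okP N P /\
   lev (3 * S (fst x) + 1) (csub (csub f (evP (snd x))) (evP P)) (del (S (fst x))) /\
   (lev (3 * fst x + 1) (csub f (evP (snd x))) (del (fst x)) ->
     cost (tq (fst x)) P <= C (fst x) * del (fst x))).
{ intros [m Q]; simpl fst; simpl snd.
  destruct (classic (okP N Q)) as [HQ|HQ]; [|exists []; tauto].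
  assert (HA : A (csub f (evP Q))) by (apply InA_csub; auto; apply (InA_ev N); auto).
  destruct (classic (lev (3 * m + 1) (csub f (evP Q)) (del m))) as [HL|HL].
  - destruct (proj2 (HC m) _ _ (del (S m)) HA HL (Hdel (S m))) as [P [P1 [P2 P3]]].
    exists P. intros _. split; auto. split.
    + replace (3 * S m + 1)%nat with (3 * m + 4)%nat by lia. exact P3.
    + intros _. exact P2.
  - destruct (InA_lev _ (3 * m + 1) HA) as [B HB].
    destruct (proj2 (HC m) _ _ (del (S m)) HA HB (Hdel (S m))) as [P [P1 [P2 P3]]].
    exists P. intros _. split; auto. split.
    + replace (3 * S m + 1)%nat with (3 * m + 4)%nat by lia. exact P3.
    + contradiction. }
destruct (choice _ Hstep) as [F HF].
set (Q := fix Q m := match m with O => [] | S m' => Q m' ++ F (m', Q m') end).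
assert (HQ : forall m, okP N (Q m)).
{ induction m; [easy|]. simpl. apply okP_app; auto. apply (HF (m, Q m)); auto. }
assert (HQ1 : forall m, lev (3 * S m + 1) (csub f (evP (Q (S m)))) (del (S m))).
{ intro m. simpl Q. rewrite ev_app. destruct (HF (m, Q m) (HQ m)) as [_ [H _]].
  simpl fst in H; simpl snd in H.
  replace (csub f (cadd (evP (Q m)) (evP (F (m, Q m))))) with
    (csub (csub f (evP (Q m))) (evP (F (m, Q m)))); auto.
  extensionality k; unfold csub, cadd; ring. }
exists Q. split; auto. split.
- intro m. eapply nle_weaken; [apply HQ1 | apply Hdel1].
- intro m. exists (F (S m, Q (S m))). split; [reflexivity|].
  destruct (HF (S m, Q (S m)) (HQ (S m))) as [_ [_ H]].
  eapply Rle_trans; [apply H, HQ1 | apply Hdel1].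
Qed.

(** For fixed [t] all late corrections have [tq m >= t] and hence cost at most [(/2) ^ m] at [t]. So
    the coefficients of the polynomials are Cauchy in every weighted norm on words, and their limit
    is the required series. *)
Lemma fcalc_surjective f : A f -> exists c, InFN N c /\ fcalc n q r Rr c gens f.
Proof.
intro Hf. destruct (telescope f Hf) as [Q [HQ [HQ1 HQ2]]].
assert (Htail : forall m d, exists P, Q (S m + d)%nat = Q (S m) ++ P /\
   forall t, 0 <= t <= tq (S m) -> cost t P <= lsumR (fun l => (/2) ^ l) (seq (S m) d)).
{ intros m d. induction d as [|d [P [IH1 IH2]]].
  - exists []. rewrite Nat.add_0_r, app_nil_r. split; auto. intros; unfold cost; simpl; lra.
  - destruct (HQ2 (m + d)%nat) as [P' [E1 E2]]. exists (P ++ P'). split.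
    + replace (S m + S d)%nat with (S (S (m + d))) by lia. rewrite E1.
      change (S (m + d)) with (S m + d)%nat. rewrite IH1. now rewrite app_assoc.
    + intros t Ht. rewrite cost_app, seq_S, lsumR_app. specialize (IH2 t Ht).
      change (lsumR (fun l => (/2) ^ l) [(S m + d)%nat]) with ((/2) ^ S (m + d) + 0).
      assert (cost t P' <= cost (tq (S (m + d))) P'); [|lra].
      apply cost_mono. split; [lra|]. eapply Rle_trans; [apply Ht|]. unfold tq.
      apply Rplus_le_compat_r, le_INR. lia. }
destruct (l1_complete (fun m => coefP (Q m))
   (fun w => exists t, 0 < t /\ w = fun alpha : word => t ^ length alpha)) as [c Hc].
- intros w k [t [Ht ->]]. now apply pow_lt.
- exists (fun alpha => 1 ^ length alpha), 1. split; [lra | reflexivity].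
- intros w [t [Ht ->]] eps He.
  destruct (pow_small (/2) (eps / 2)) as [M1 HM1]; [lra | lra |].
  destruct (INR_unbounded t) as [M2 HM2].
  assert (K : forall m p, (S (M1 + M2) <= m)%nat -> (m <= p)%nat ->
     ub (fun k => Cmod (Csub (coefP (Q p) k) (coefP (Q m) k)) * t ^ length k) eps).
  { intros m p Hm Hp. destruct m as [|m]; [lia|].
    destruct (Htail m (p - S m)%nat) as [P [E1 E2]].
    replace (S m + (p - S m))%nat with p in E1 by lia. rewrite E1.
    eapply ub_weaken.
    - eapply ub_le; [|apply (coefP_ub t P); lra]. intro k. simpl. rewrite coefP_app. right.
      f_equal. f_equal. ring.
    - eapply Rle_trans; [apply E2|].
      + split; [lra|]. unfold tq. assert (INR M2 <= INR (S m)) by (apply le_INR; lia). lra.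
      + eapply Rle_trans; [apply geom_half|]. specialize (HM1 (S m) ltac:(lia)). lra. }
  exists (S (M1 + M2)). intros m p Hm Hp. destruct (Nat.le_ge_cases m p) as [H|H].
  + eapply ub_le; [|apply (K m p Hm H)]. intro k. simpl. rewrite Cmod_sub_sym. lra.
  + apply (K p m Hp H).
- assert (Hlim : forall t, 0 < t -> forall eps, 0 < eps -> exists M, forall m, (M <= m)%nat ->
     ub (fun k => Cmod (Csub (coefP (Q m) k) (c k)) * t ^ length k) eps).
  { intros t Ht. apply Hc. eauto. }
  assert (Hout : forall alpha, ~ okw N alpha -> c alpha = C0).
  { intros alpha Ha. apply Cmod_eq0. apply Rle_antisym; [|apply Cmod_nonneg].
    apply Rnot_lt_le. intro Hp.
    destruct (Hlim 1 ltac:(lra) (Cmod (c alpha) / 2) ltac:(lra)) as [M HM].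
    pose proof (ub_term _ _ alpha (HM M (Nat.le_refl _))) as T. simpl in T.
    rewrite pow1, coefP_out, Cmod_sub_sym in T; auto.
    replace (Csub (c alpha) C0) with (c alpha) in T by ring. lra. }
  exists c. split; [split|].
  + exact Hout.
  + intros t Ht. destruct (Hlim t Ht 1 ltac:(lra)) as [M HM].
    exists (cost t (Q M) + 1).
    eapply ub_le; [|exact (ub_plus _ _ _ _ (coefP_ub t (Q M) ltac:(lra)) (HM M (Nat.le_refl _)))].
    intro alpha. simpl. rewrite <- Rmult_plus_distr_r. apply Rmult_le_compat_r; [apply pow_le; lra|].
    rewrite Cmod_sub_sym. replace (c alpha) with (Cadd (coefP (Q M) alpha) (Csub (c alpha) (coefP (Q M) alpha)))
      at 1 by ring. apply Cmod_add.
  + split; auto. intros rho tau Had eps He.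
    destruct (adm_lev rho tau Had) as [p Hp].
    destruct (gens_bound p) as [t [Ht Hgb]].
    destruct (Hlim t Ht (eps / 3) ltac:(lra)) as [M1 HM1].
    destruct (pow_small (/2) (eps / 3)) as [M2 HM2]; [lra | lra |].
    set (m := (M1 + M2 + p)%nat).
    (* Once [G] contains the words of this polynomial, the sum over [G] is its value plus the
       contribution of [c - coefP], which is small uniformly in [G]; hence the convergence is
       unconditional. *)
    exists (map snd (Q (S m))). intros G HG HI.
    pose proof (coefP_ev (Q (S m)) G HG HI) as E.
    assert (B1 : lev p (lsumA (fun alpha => cscale (Csub (c alpha) (coefP (Q (S m)) alpha)) (we alpha)) G)
       (eps / 3)).
    { eapply nle_weaken.
      - apply nle_lsumA with (M := fun alpha => Cmod (Csub (coefP (Q (S m)) alpha) (c alpha)) * t ^ length alpha);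
          [apply radm|].
        intros alpha _. rewrite Cmod_sub_sym. destruct (classic (okw N alpha)) as [Ha|Ha].
        + apply nle_scale, lev_word; auto; lra.
        + rewrite Hout, coefP_out by auto.
          replace (cscale (Csub C0 C0) (we alpha)) with czero
            by (extensionality k; unfold cscale, czero; ring).
          apply nle_zero. apply Rmult_le_pos; [apply Cmod_nonneg | apply pow_le; lra].
      - apply (HM1 (S m) ltac:(lia) G HG). }
    assert (B2 : lev p (csub (evP (Q (S m))) f) (eps / 3)).
    { apply nle_sym. apply lev_anti with (p := (3 * S m + 1)%nat); [lia|].
      eapply nle_weaken; [apply HQ1 | apply HM2; lia]. }
    pose proof (lev_add _ _ _ _ _ B1 B2) as T.
    apply (Hp p (Nat.le_refl _)) in T.
    assert (E' : csub (lsumA (fun alpha => cscale (c alpha) (we alpha)) G) f =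
      cadd (lsumA (fun alpha => cscale (Csub (c alpha) (coefP (Q (S m)) alpha)) (we alpha)) G)
        (csub (evP (Q (S m))) f)).
    { rewrite (lsumA_ext _ (fun alpha => cadd (cscale (Csub (c alpha) (coefP (Q (S m)) alpha)) (we alpha))
        (cscale (coefP (Q (S m)) alpha) (we alpha)))).
      - rewrite lsumA_plus, E. extensionality k; unfold csub, cadd; ring.
      - intros alpha _. extensionality k; unfold cadd, cscale; ring. }
    rewrite E'. eapply Rle_lt_trans; [eapply nle_cnorm; [now apply adm_rad | exact T] | lra].
Qed.

End Surjectivity.
End Algebra.

Theorem theorem7p17 (n : nat) (q : nat -> nat -> CC) (r : nat -> R) (Rr : nat -> option R)
  (hqdiag : forall i, (i < n)%nat -> q i i = C1)
  (hqanti : forall i j, (i < n)%nat -> (j < n)%nat -> q j i = Cinv (q i j))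
  (hqabs : forall i j, (i < n)%nat -> (j < n)%nat -> Cmod (q i j) = 1)
  (hr0 : forall i, (i < n)%nat -> 0 <= r i)
  (hrR : forall i, (i < n)%nat -> ltext (r i) (Rr i)) :
  HFG_Oq n q r Rr.
Proof.
split; [now apply FrechetAM_holds|].
destruct (all_generators n q r Rr hqabs hr0 hrR) as [S [HS1 HS2]].
exists S. split; auto. intro a. split.
(* [a] is a value of the free functional calculus on [S], so every holomorphically closed [B]
   containing [S] contains it. *)
- intros Ha B HB HSB.
  set (gens := fun i => nth i S czero).
  assert (Hg : forall i, (i < length S)%nat -> InA n r Rr (gens i)).
  { intros i Hi. apply HS1. now apply nth_In. }
  assert (HC : covers n r Rr (length S) gens S).
  { split; auto. intros s Hs. destruct (In_nth S s czero Hs) as [i [Hi E]]. exists i. auto. }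
  destruct (fcalc_surjective n q r Rr hqabs hr0 hrR (length S) gens Hg (HS2 _ _ HC) a Ha)
    as [c [Hc1 Hc2]].
  destruct HB as [_ [_ [_ [_ [_ HB]]]]].
  apply (HB (length S) gens c a); auto.
  intros i Hi. apply HSB. now apply nth_In.
(* Conversely, the whole algebra is itself one of the holomorphically closed sets being
   intersected. *)
- intro H. apply H; auto. split; [auto|]. split; [now apply InA_cunit|].
  split; [|split; [|split]].
  + intros; now apply InA_cadd.
  + intros; now apply InA_cscale.
  + intros; now apply InA_cmul.
  + intros N b c s _ _ [Hs _]. exact Hs.
Qed.
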